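(* Let $g=0$ (homogeneous inflow conditions), assume that the dissipation parameters $\alpha_e$ are uniformly bounded over all faces $e$, all $t\in[0,T]$ and all $\bm z\in e$, let $\varepsilon_1,\varepsilon_2\ge 0$, and let $$\tau_{\mathrm{CFL}}:=\Bigl(\sup_{K\in\mathcal T,\ t\in[0,T]}\frac{1}{2|K|}\sum_{e\subset\partial K}\int_e\alpha_e(t,\bm z)\,\mathrm ds\Bigr)^{-1}\in(0,\infty]$$ (with $\tau_{\mathrm{CFL}}=\infty$ if the supremum vanishes). Then for every initial value $U^0\in\mathbb R^{n^{(x)}\times n^{(v)}}$ (given in SVD form) and every time step $\tau=T/N_T$ ($N_T\in\mathbb N$) with $0<\tau\le\tau_{\mathrm{CFL}}$, the sequence $(U^n)_{n=0}^{N_T}$ generated by the rank-adaptive SAT scheme $U^{n+1}=\Phi_\tau(t^n,U^n;\varepsilon_1,\varepsilon_2)$ satisfies $$\|U^n\|_F\le\|U^0\|_F$$ for all $n$ with $t^n=n\tau\le T$.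
   Context: **Problem.** Let $d\ge1$, $T>0$, $\Omega^{(x)}\subset\mathbb R^d$ a bounded domain with piecewise linear (piecewise planar) boundary, $\Omega^{(v)}\subset\mathbb R^d$ a bounded polytope, $\Omega=\Omega^{(x)}\times\Omega^{(v)}$, $\bm z=(\bm x,\bm v)$. The electric field $\bm E\in C([0,T],W^{1,\infty}(\Omega^{(x)},\mathbb R^d))$ is prescribed and the phase-space velocity is $\bm a(t,\bm z)=(\bm v,-\bm E(t,\bm x))$, which satisfies $\nabla_{\bm z}\cdot\bm a=0$. The linear Vlasov equation is $\partial_t u+\nabla_{\bm z}\cdot(\bm a u)=0$ on $(0,T)\times\Omega$, with inflow data $u=g$ on the spatial inflow boundary (points of $\partial\Omega^{(x)}\times\Omega^{(v)}$ with $\bm n^{(x)}\cdot\bm v<0$) and $u=0$ on the velocity inflow boundary (points of $\Omega^{(x)}\times\partial\Omega^{(v)}$ with $-\bm n^{(v)}\cdot\bm E(t,\bm x)<0$); $g$ is extended by $0$ to the velocity inflow boundary. Here $\bm n^{(x)},\bm n^{(v)}$ are outward unit normals. **Finite volume space.** $\mathcal T^{(x)}=\{K_i^{(x)}\}_{i=1}^{n^{(x)}}$ and $\mathcal T^{(v)}=\{K_j^{(v)}\}_{j=1}^{n^{(v)}}$ are finite meshes of $\Omega^{(x)}$, $\Omega^{(v)}$ consisting of open polytopal cells (possibly unstructured), and $\mathcal T=\{K_i^{(x)}\times K_j^{(v)}\}$ is the product mesh. A matrix $U=[u_{ij}]\in\mathbb R^{n^{(x)}\times n^{(v)}}$ is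 identified with the piecewise constant function $u_h$ having the value $u_h|_K=u_{ij}/\sqrt{|K|}$ on $K=K_i^{(x)}\times K_j^{(v)}$; thus $\|u_h\|_{L_2(\Omega)}=\|U\|_F$ (Frobenius norm). **Numerical fluxes.** Faces $e$ of cells are planar; $\bm n_{K,e}$ is the outward unit normal of $K$ on $e\subset\partial K$. For a cell $K$ and face $e\subset\partial K$ let $u^-$ be the value of $u_h$ in $K$, and $u^+$ the value of $u_h$ in the neighbouring cell across $e$ if $e$ is interior, or $u^+=g$ if $e\subset\partial\Omega$ (on the outflow part of a boundary face the exterior value is irrelevant, since its coefficient in the upwind flux vanishes). The flux is $$\hat f_e(t,\bm z,u^-,u^+,\bm n_{K,e})=\bm n_{K,e}\cdot\bm a(t,\bm z)\,\frac{u^-+u^+}{2}+\frac{\alpha_e(t,\bm z)}{2}(u^--u^+).$$ The dissipation parameter $\alpha_e$ is one of: upwind, $\alpha_e(t,\bm z)=|\bm n_e\cdot\bm a(t,\bm z)|$; local Lax–Friedrichs, $\alpha_e(t)$ constant on $e$ with $\alpha_e(t)\ge\max_{\bm z\in e}|\bm n_e\cdot\bm a(t,\bm z)|$; global Lax–Friedrichs, a common $\alpha(t)\ge\max_{e}\max_{\bm z\in e}|\bm n_e\cdot\bm a(t,\bm z)|$ for all faces on which this flux is applied. On all boundary faces $e\subset\partial\Omega$ the upwind choice is used. **Semi-discrete right-hand side.** $F_h(t,U)\in\mathbb R^{n^{(x)}\times n^{(v)}}$ is defined for $K=K_i^{(x)}\times K_j^{(v)}$ by $$[F_h(t,U)]_{ij}=-|K|^{-1/2}\sum_{e\subset\partial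 K}\int_e\hat f_e(t,\bm z,u^-,u^+,\bm n_{K,e})\,\mathrm ds .$$ It is affine-linear in $U$, $F_h(t,U)=L_h(t,U)+B_h(t)$, where $B_h$ collects the inflow data; $B_h=0$ if $g=0$. **Rank-adaptive SAT scheme.** $t^n=n\tau$, $\tau=T/N_T$. For $\varepsilon\ge0$ and a matrix $M$, $\mathcal T^{\mathrm{svd}}_\varepsilon(M)=Y\Sigma Z^\top$ denotes a truncated singular value decomposition of $M$ (keeping leading singular values and vectors), with $Y^\top Y=I$, $Z^\top Z=I$, $\|Y\Sigma Z^\top-M\|_F\le\varepsilon$ and $\|Y\Sigma Z^\top\|_F\le\|M\|_F$. $\operatorname{ortho}[A,B]$ denotes a matrix whose columns form an orthonormal basis of the column span of $[A,B]$. ''SVD form'' of $U^n$ means $U^n=X^nS^nV^{n,\top}$ with $X^n,V^n$ having orthonormal columns and $S^n$ square diagonal with nonnegative entries. One step $U^{n+1}=\Phi_\tau(t^n,U^n;\varepsilon_1,\varepsilon_2)$ is: 1. $\bar X\bar S\bar V^\top=\mathcal T^{\mathrm{svd}}_{\varepsilon_1}(F_h(t^n,U^n))$; 2. $\tilde X=\operatorname{ortho}[X^n,\bar X]$, $\tilde V=\operatorname{ortho}[V^n,\bar V]$; 3. $\tilde S^n=(\tilde X^\top X^n)S^n(\tilde V^\top V^n)^\top$, $\tilde S^{n+1}=\tilde S^n+\tau\,\tilde X^\top F_h(t^n,U^n)\tilde V$; 4. $U^{n+1}=X^{n+1}S^{n+1}V^{n+1,\top}=\mathcal T^{\mathrm{svd}}_{\varepsilon_2}(\tilde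 X\tilde S^{n+1}\tilde V^\top)$. *)

(* Defs.v *)
From HB Require Import structures.
From mathcomp Require Import all_boot all_order all_algebra.
From mathcomp Require Import all_classical all_reals all_analysis.
Set Implicit Arguments.
Unset Strict Implicit.
Unset Printing Implicit Defensive.
Import Order.TTheory GRing.Theory Num.Theory.
Import numFieldNormedType.Exports.
Local Open Scope classical_set_scope.
Local Open Scope ring_scope.

(* 'rV[R]_n carries the sigma-algebra generated by the coordinates; it
   coincides with the Borel sigma-algebra. *)
Definition measure_rV_display : measure_display.
Proof. exact: default_measure_display. Qed.

Section measurable_rV.
Context {R : realType} {n : nat}.
Let coors : 'I_n -> 'rV[R]_n -> R := fun i x => x 0 i.

Let rV_set0 : g_sigma_preimage coors set0.
Proof. exact: sigma_algebra0. Qed.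

Let rV_setC A : g_sigma_preimage coors A -> g_sigma_preimage coors (~` A).
Proof. exact: sigma_algebraC. Qed.

Let rV_bigcup (F : _^nat) : (forall i, g_sigma_preimage coors (F i)) ->
  g_sigma_preimage coors (\bigcup_i (F i)).
Proof. exact: sigma_algebra_bigcup. Qed.

HB.instance Definition _ := @isMeasurable.Build measure_rV_display
  'rV[R]_n (g_sigma_preimage coors) rV_set0 rV_setC rV_bigcup.

End measurable_rV.

Lemma measurable_coord (R : realType) n (i : 'I_n) :
  measurable_fun [set: 'rV[R]_n] (fun x : 'rV[R]_n => x 0 i).
Proof.
move=> _ Y mY; rewrite setTI; apply: sub_sigma_algebra => /=.
rewrite -bigcup_seq/=; exists i => /=; first by rewrite mem_index_enum.
by exists Y => //; rewrite setTI.
Qed.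

Lemma measurable_fun_rV (R : realType) d (T : measurableType d) n
    (f : T -> 'rV[R]_n) :
  (forall i, measurable_fun [set: T] (fun x => f x 0 i)) ->
  measurable_fun [set: T] f.
Proof.
move=> mf _ A; rewrite setTI.
suff sub : @measurable _ 'rV[R]_n `<=` [set B | measurable (f @^-1` B)].
  by move=> /sub.
apply: smallest_sub.
  split => /=.
  - by rewrite preimage_set0.
  - by move=> B mB; rewrite setTD preimage_setC; exact: measurableC.
  - by move=> F mF; rewrite preimage_bigcup; exact: bigcup_measurable.
rewrite -bigcup_seq; apply: bigcup_sub => i _ _ [B mB <-] /=.
by rewrite setTI -[X in measurable X]setTI; exact: (mf i).
Qed.

Definition vcons {R : realType} {n} (p : R * 'rV[R]_n) : 'rV[R]_n.+1 :=
  \row_i if unlift ord0 i is Some j then p.2 0 j else p.1.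

Definition vuncons {R : realType} {n} (x : 'rV[R]_n.+1) : R * 'rV[R]_n :=
  (x 0 ord0, \row_j x 0 (lift ord0 j)).

Lemma vconsK {R : realType} {n} : cancel (@vcons R n) vuncons.
Proof.
move=> [a x]; rewrite /vcons /vuncons mxE unlift_none; congr pair.
by apply/rowP => j; rewrite !mxE liftK.
Qed.

Lemma measurable_vcons {R : realType} {n} :
  measurable_fun [set: R * 'rV[R]_n] (@vcons R n).
Proof.
apply: measurable_fun_rV => i; rewrite /vcons.
under eq_fun do rewrite mxE.
case: unliftP => [j _|_]; last exact: measurable_fst.
by apply: (measurableT_comp (measurable_coord j)).
Qed.

Lemma measurable_vuncons {R : realType} {n} :
  measurable_fun [set: 'rV[R]_n.+1] (@vuncons R n).
Proof.
apply/measurable_fun_pairP; split; first exact: measurable_coord.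
apply: measurable_fun_rV => i; rewrite /vuncons /=.
by under eq_fun do rewrite mxE; exact: measurable_coord.
Qed.

Section vcons_measure.
Local Open Scope ereal_scope.
Context {R : realType} {n : nat}.
Variable mu : {sigma_finite_measure set 'rV[R]_n -> \bar R}.

Definition vcons_measure : set 'rV[R]_n.+1 -> \bar R :=
  pushforward (@lebesgue_measure R \x mu) vcons.

Let vm0 : vcons_measure set0 = 0.
Proof. by rewrite /vcons_measure /pushforward preimage_set0 measure0. Qed.

Let vm_ge0 A : 0 <= vcons_measure A.
Proof. by rewrite /vcons_measure /pushforward. Qed.

Let mvcons (A : set 'rV[R]_n.+1) : measurable A -> measurable (vcons @^-1` A).
Proof. by move=> mA; rewrite -[X in measurable X]setTI; exact: measurable_vcons. Qed.

Let vm_sigma_additive : semi_sigma_additive vcons_measure.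
Proof.
move=> F mF tF mUF; rewrite /vcons_measure /pushforward preimage_bigcup.
apply: measure_semi_sigma_additive.
- by move=> k; exact: mvcons.
- apply/trivIsetP => /= i j _ _ ij; rewrite -preimage_setI.
  by move/trivIsetP : tF => /(_ _ _ _ _ ij) ->//; rewrite preimage_set0.
- by rewrite -preimage_bigcup; exact: mvcons.
Qed.

HB.instance Definition _ := isMeasure.Build _ _ _ vcons_measure
  vm0 vm_ge0 vm_sigma_additive.

Let vm_sigma_finite : sigma_finite setT vcons_measure.
Proof.
have /sigma_finiteP[F [TF ndF Foo]] := sigma_finiteT (@lebesgue_measure R).
have /sigma_finiteP[G [TG ndG Goo]] := sigma_finiteT mu.
exists (fun k => vuncons @^-1` (F k `*` G k)).
  rewrite -preimage_bigcup (_ : \bigcup_k _ = setT) ?preimage_setT//.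
  rewrite -setXTT TF TG predeqE => -[x y]; split.
    by move=> [n0 _ []/= ? ?]; split; exists n0.
  move=> [/= [k _ Fkx] [l _ Gly]]; exists (maxn k l) => //; split.
  - by move: x Fkx; exact/subsetPset/ndF/leq_maxl.
  - by move: y Gly; exact/subsetPset/ndG/leq_maxr.
move=> k; have [mFk Fkoo] := Foo k; have [mGk Gkoo] := Goo k; split.
  rewrite -[X in measurable X]setTI; apply: measurable_vuncons => //.
  exact: measurableX.
rewrite /vcons_measure /pushforward -comp_preimage.
rewrite (_ : vuncons \o vcons = id); last first.
  by apply/funext => p /=; exact: vconsK.
by rewrite preimage_id product_measure1E// lte_mul_pinfty// ge0_fin_numE.
Qed.

HB.instance Definition _ := Measure_isSigmaFinite.Build _ _ _ vcons_measure
  vm_sigma_finite.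

End vcons_measure.

Fixpoint lebesgue_rV (R : realType) (n : nat) :
    {sigma_finite_measure set 'rV[R]_n -> \bar R} :=
  match n with
  | 0 => \d_(0 : 'rV[R]_0)
  | m.+1 => vcons_measure (lebesgue_rV R m)
  end.

Definition dot (R : realType) d (u v : 'rV[R]_d) : R := \sum_i u 0 i * v 0 i.

Definition boundary (T : topologicalType) (A : set T) : set T :=
  closure A `\` A^°.

(* n is an outward normal of A at the point x, and the boundary of A is flat
   near x: close to x, A is the half-space below the hyperplane through x. *)
Definition outward_normal (R : realType) d (A : set 'rV[R]_d) (x n : 'rV[R]_d) :=
  \forall y \near x, A y <-> dot n (y - x) < 0.

Definition hyperplane (R : realType) d (h : 'rV[R]_d * R) : set 'rV[R]_d :=
  [set x | dot h.1 x = h.2].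

Definition codim2_affine (R : realType) d (S : set 'rV[R]_d) :=
  exists h1 h2 : 'rV[R]_d * R,
    row_free (col_mx h1.1 h2.1) /\ S = hyperplane h1 `&` hyperplane h2.

(* S is contained in the union of finitely many affine subspaces of
   codimension two (the empty set if d = 1). *)
Definition within_ridges (R : realType) d (S : set 'rV[R]_d) :=
  exists (k : nat) (L : 'I_k -> set 'rV[R]_d),
    (forall i, codim2_affine (L i)) /\ S `<=` \bigcup_i L i.

(* Outside of the ridges, the boundary is covered by finitely many
   hyperplanes, each boundary point being flat with a unit normal. *)
Definition piecewise_planar_boundary (R : realType) d (A : set 'rV[R]_d) :=
  exists (k : nat) (h : 'I_k -> 'rV[R]_d * R),
    (forall i, dot (h i).1 (h i).1 = 1) /\
    within_ridges (boundary A `\`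
      \bigcup_i [set x | hyperplane (h i) x /\ outward_normal A x (h i).1]).

Definition polytopal_domain (R : realType) d (A : set 'rV[R]_d) :=
  [/\ A !=set0, open A, connected A, bounded_set A &
      piecewise_planar_boundary A].

(* A mesh with nc cells.  Every face e lies in one hyperplane and carries a
   fixed unit normal n_e; [finner e] is the cell for which n_e is outward, and
   [fouter e] is the neighbouring cell across e, or None if e lies on the
   boundary of the meshed domain.  Faces are taken relatively open, without
   their lower-dimensional edges; cells need not be convex, and hanging nodes
   are allowed, a planar side of a cell being split into several faces. *)
Record mesh (R : realType) d (nc : nat) := Mesh {
  cell : 'I_nc -> set 'rV[R]_d;
  nface : nat;
  face : 'I_nface -> set 'rV[R]_d;
  fplane : 'I_nface -> 'rV[R]_d * R;
  finner : 'I_nface -> 'I_nc;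
  fouter : 'I_nface -> option 'I_nc }.

Definition fnormal (R : realType) d nc (M : mesh R d nc) (e : 'I_(nface M)) :=
  (fplane e).1.

Definition is_mesh (R : realType) d nc (Omega : set 'rV[R]_d)
    (M : mesh R d nc) :=
  [/\ [/\ forall i, polytopal_domain (cell M i),
          trivIset setT (cell M),
          forall i, cell M i `<=` Omega &
          Omega `<=` \bigcup_i closure (cell M i)],
      [/\ forall e : 'I_(nface M), face e !=set0,
          forall e : 'I_(nface M), dot (fnormal e) (fnormal e) = 1,
          forall e : 'I_(nface M),
            exists2 O, open O & face e = O `&` hyperplane (fplane e) &
          trivIset setT (@face _ _ _ M)],
      forall (e : 'I_(nface M)) x, face e x ->
        outward_normal (cell M (finner e)) x (fnormal e) /\
        (if fouter e is Some i then outward_normal (cell M i) x (- fnormal e)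
         else outward_normal Omega x (fnormal e)) &
      forall i, within_ridges (boundary (cell M i) `\`
        \bigcup_(e in [set e : 'I_(nface M) |
                        finner e = i \/ fouter e = Some i]) face e)].

Fixpoint Ck (R : realType) d (k : nat) (phi : 'rV[R]_d -> R) : Prop :=
  match k with
  | 0 => continuous phi
  | m.+1 => (forall x v, derivable phi x v) /\ forall v, Ck m ('D_v phi)
  end.

Definition test_function (R : realType) d (A : set 'rV[R]_d)
    (phi : 'rV[R]_d -> R) :=
  [/\ forall k, Ck k phi, compact (closure [set x | phi x != 0]) &
      closure [set x | phi x != 0] `<=` A].

Definition weak_partial (R : realType) d (A : set 'rV[R]_d) (i : 'I_d)
    (f g : 'rV[R]_d -> R) :=
  forall phi, test_function A phi ->
    \int[lebesgue_rV R d]_(x in A) (f x * 'D_(delta_mx 0 i) phi x) =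
    - \int[lebesgue_rV R d]_(x in A) (g x * phi x).

Definition Loo_norm_le (R : realType) d (A : set 'rV[R]_d)
    (f : 'rV[R]_d -> R) (M : R) :=
  measurable_fun A f /\
  ('N[lebesgue_rV R d]_(+oo) [EFin \o (f \_ A)] <= M%:E)%E.

(* f is in W^{1,oo}(A), and f and its weak partial derivatives are bounded by
   M in L^oo(A). *)
Definition W1oo_norm_le (R : realType) d (A : set 'rV[R]_d)
    (f : 'rV[R]_d -> R) (M : R) :=
  Loo_norm_le A f M /\
  forall i, exists2 g, weak_partial A i f g & Loo_norm_le A g M.

(* E(t, .) is given by its continuous representative, so that its point values
   are meaningful. *)
Definition C_W1oo (R : realType) d (T : R) (A : set 'rV[R]_d)
    (E : R -> 'rV[R]_d -> 'rV[R]_d) :=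
  [/\ forall t, 0 <= t <= T -> {in A, continuous (E t)},
      forall t, 0 <= t <= T -> forall l, exists M,
        W1oo_norm_le A (fun x => E t x 0 l) M &
      forall t, 0 <= t <= T -> forall eps, 0 < eps ->
        exists2 delta, 0 < delta & forall s, 0 <= s <= T -> `|s - t| < delta ->
          forall l, W1oo_norm_le A (fun x => E s x 0 l - E t x 0 l) eps].

Definition phase (R : realType) d := ('rV[R]_d * 'rV[R]_d)%type.

Definition pdot (R : realType) d (u w : phase R d) : R :=
  dot u.1 w.1 + dot u.2 w.2.

Definition phase_velocity (R : realType) d (E : R -> 'rV[R]_d -> 'rV[R]_d)
    (t : R) (z : phase R d) : phase R d := (z.2, - E t z.1).

Definition phase_lebesgue (R : realType) d : set (phase R d) -> \bar R :=
  (lebesgue_rV R d \x lebesgue_rV R d)%E.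

HB.instance Definition _ (R : realType) d := Measure.copy (@phase_lebesgue R d)
  (lebesgue_rV R d \x lebesgue_rV R d)%E.

(* Surface integral over a subset e of the hyperplane n.z = c, n a unit vector:
   the Lebesgue integral, over the cylinder of height one erected on e in the
   direction n, of f extended constantly in that direction. *)
Definition foot (R : realType) d (n : phase R d) (c : R) (z : phase R d) :
  phase R d := z - (pdot n z - c) *: n.

Definition surface_integral (R : realType) d (n : phase R d) (c : R)
    (e : set (phase R d)) (f : phase R d -> R) : R :=
  \int[@phase_lebesgue R d]_(z in
    [set z | 0 < pdot n z - c < 1 /\ e (foot n c z)]) f (foot n c z).

Section product_mesh.
Context (R : realType) (d nx nv : nat).
Variables (Mx : mesh R d nx) (Mv : mesh R d nv).

Definition pcell (K : 'I_nx * 'I_nv) : set (phase R d) :=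
  cell Mx K.1 `*` cell Mv K.2.

Definition pvol (K : 'I_nx * 'I_nv) : R := fine (@phase_lebesgue R d (pcell K)).

(* The faces of the product cells: (spatial face) x (velocity cell) and
   (spatial cell) x (velocity face). *)
Definition pface : finType :=
  ('I_(nface Mx) * 'I_nv + 'I_nx * 'I_(nface Mv))%type.

Definition pface_set (e : pface) : set (phase R d) :=
  match e with
  | inl p => face p.1 `*` cell Mv p.2
  | inr p => cell Mx p.1 `*` face p.2
  end.

Definition pnormal (e : pface) : phase R d :=
  match e with
  | inl p => (fnormal p.1, 0)
  | inr p => (0, fnormal p.2)
  end.

Definition poffset (e : pface) : R :=
  match e with
  | inl p => (fplane p.1).2
  | inr p => (fplane p.2).2
  end.

Definition pinner (e : pface) : 'I_nx * 'I_nv :=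
  match e with
  | inl p => (finner p.1, p.2)
  | inr p => (p.1, finner p.2)
  end.

Definition pouter (e : pface) : option ('I_nx * 'I_nv) :=
  match e with
  | inl p => omap (fun i => (i, p.2)) (fouter p.1)
  | inr p => omap (fun j => (p.1, j)) (fouter p.2)
  end.

Definition face_of (K : 'I_nx * 'I_nv) (e : pface) : bool :=
  (pinner e == K) || (pouter e == Some K).

Definition cell_normal (K : 'I_nx * 'I_nv) (e : pface) : phase R d :=
  if pinner e == K then pnormal e else - pnormal e.

Definition neighbour (K : 'I_nx * 'I_nv) (e : pface) :
    option ('I_nx * 'I_nv) :=
  if pinner e == K then pouter e else Some (pinner e).

Definition face_integral (e : pface) (f : phase R d -> R) : R :=
  surface_integral (pnormal e) (poffset e) (pface_set e) f.

Inductive flux_type := Upwind | LocalLF | GlobalLF.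

Variable E : R -> 'rV[R]_d -> 'rV[R]_d.

Definition normal_speed (e : pface) (t : R) (z : phase R d) : R :=
  `|pdot (pnormal e) (phase_velocity E t z)|.

Definition dissipation (T : R) (kind : pface -> flux_type)
    (alpha : pface -> R -> phase R d -> R) :=
  (forall e, pouter e = None -> kind e = Upwind) /\
  exists alpha_glob : R -> R, forall t, 0 <= t <= T -> forall e,
    match kind e with
    | Upwind => forall z, pface_set e z -> alpha e t z = normal_speed e t z
    | LocalLF => exists c, forall z, pface_set e z ->
        alpha e t z = c /\ normal_speed e t z <= c
    | GlobalLF => forall z, pface_set e z ->
        alpha e t z = alpha_glob t /\ normal_speed e t z <= alpha_glob t
    end.

Variables (alpha : pface -> R -> phase R d -> R) (g : R -> phase R d -> R).

Definition flux (t : R) (K : 'I_nx * 'I_nv) (e : pface) (z : phase R d)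
    (um up : R) : R :=
  pdot (cell_normal K e) (phase_velocity E t z) * ((um + up) / 2) +
  alpha e t z / 2 * (um - up).

(* g on the spatial part of the boundary, 0 on the velocity part. *)
Definition boundary_value (e : pface) (t : R) (z : phase R d) : R :=
  if e is inl _ then g t z else 0.

Definition cell_value (U : 'M[R]_(nx, nv)) (K : 'I_nx * 'I_nv) : R :=
  U K.1 K.2 / Num.sqrt (pvol K).

Definition outer_value (U : 'M[R]_(nx, nv)) (K : 'I_nx * 'I_nv) (e : pface)
    (t : R) (z : phase R d) : R :=
  if neighbour K e is Some K' then cell_value U K' else boundary_value e t z.

Definition Fh (t : R) (U : 'M[R]_(nx, nv)) : 'M[R]_(nx, nv) :=
  \matrix_(i, j) (- (Num.sqrt (pvol (i, j)))^-1 *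
    \sum_(e | face_of (i, j) e) face_integral e (fun z =>
      flux t (i, j) e z (cell_value U (i, j)) (outer_value U (i, j) e t z))).

Definition tau_CFL (T : R) : \bar R :=
  ((ereal_sup [set y | exists K (t : R), (0 <= t <= T)%R /\
      y = ((2 * pvol K)^-1 *
           \sum_(e | face_of K e) face_integral e (alpha e t))%R%:E])^-1)%E.

End product_mesh.

Section SAT.
Context (R : realType).

Definition frob m n (A : 'M[R]_(m, n)) : R :=
  Num.sqrt (\sum_i \sum_j A i j ^+ 2).

Definition orthonormal_cols m n (A : 'M[R]_(m, n)) := A^T *m A = 1%:M.

Definition nonneg_diag n (S : 'M[R]_n) := is_diag_mx S /\ forall i, 0 <= S i i.

(* Y Sg Z^T is a truncation, with error at most eps, of the singular value
   decomposition [Y Y'] diag(Sg, Sg') [Z Z']^T of M, keeping leading singular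
   values. *)
Definition trunc_svd (eps : R) m n (M : 'M[R]_(m, n)) r
    (Y : 'M[R]_(m, r)) (Sg : 'M[R]_r) (Z : 'M[R]_(n, r)) :=
  [/\ orthonormal_cols Y /\ orthonormal_cols Z,
      nonneg_diag Sg,
      exists r' (Y' : 'M[R]_(m, r')) (Sg' : 'M[R]_r') (Z' : 'M[R]_(n, r')),
        [/\ orthonormal_cols (row_mx Y Y') /\ orthonormal_cols (row_mx Z Z'),
            nonneg_diag Sg',
            M = Y *m Sg *m Z^T + Y' *m Sg' *m Z'^T &
            forall i j, Sg' j j <= Sg i i],
      frob (Y *m Sg *m Z^T - M) <= eps &
      frob (Y *m Sg *m Z^T) <= frob M].

(* Q = ortho A; mxalgebra's subspaces are row spaces, hence the transposes. *)
Definition ortho m n (A : 'M[R]_(m, n)) q (Q : 'M[R]_(m, q)) :=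
  orthonormal_cols Q /\ (Q^T :=: A^T)%MS.

Record factored (nx nv : nat) := Factored {
  frank : nat;
  fX : 'M[R]_(nx, frank);
  fS : 'M[R]_frank;
  fV : 'M[R]_(nv, frank) }.

Definition mat nx nv (U : factored nx nv) : 'M[R]_(nx, nv) :=
  fX U *m fS U *m (fV U)^T.

Definition svd_form nx nv (U : factored nx nv) :=
  [/\ orthonormal_cols (fX U), orthonormal_cols (fV U) & nonneg_diag (fS U)].

(* U1 is a possible outcome of one step from U0; the truncated singular value
   decompositions and orthonormal bases are not unique. *)
Definition SAT_step nx nv (F : R -> 'M[R]_(nx, nv) -> 'M[R]_(nx, nv))
    (eps1 eps2 tau t : R) (U0 U1 : factored nx nv) :=
  exists (r : nat) (Xb : 'M[R]_(nx, r)) (Sb : 'M[R]_r) (Vb : 'M[R]_(nv, r))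
         (p q : nat) (Xt : 'M[R]_(nx, p)) (Vt : 'M[R]_(nv, q)),
    let S0 := (Xt^T *m fX U0) *m fS U0 *m (Vt^T *m fV U0)^T in
    let S1 := S0 + tau *: (Xt^T *m F t (mat U0) *m Vt) in
    [/\ trunc_svd eps1 (F t (mat U0)) Xb Sb Vb,
        ortho (row_mx (fX U0) Xb) Xt,
        ortho (row_mx (fV U0) Vb) Vt &
        trunc_svd eps2 (Xt *m S1 *m Vt^T) (fX U1) (fS U1) (fV U1)].

End SAT.

(* Main.v *)
Require Import Defs.
From HB Require Import structures.
From mathcomp Require Import all_boot all_order all_algebra.
From mathcomp Require Import all_classical all_reals all_analysis.
From mathcomp Require Import measurable_realfun ring lra.
Set Implicit Arguments.
Unset Strict Implicit.
Unset Printing Implicit Defensive.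
Import Order.TTheory GRing.Theory Num.Theory.
Import numFieldNormedType.Exports.
Local Open Scope classical_set_scope.
Local Open Scope ring_scope.

(** In terms of the cell averages, one explicit Euler step of the finite volume
    scheme replaces the value in each cell by a convex combination of the values
    in the cell and in its neighbours, and it does so in such a way that the sum
    of the squares, weighted by the cell volumes, does not grow.  The projection
    onto the augmented bases and the truncation of the singular value
    decomposition do not increase the Frobenius norm either ([SAT_step_le]).

    Let [A e] and [N e] be the integrals over a face of the dissipation
    parameter and of the normal velocity.  The flux is monotone because [N e] is
    at most [A e] in absolute value, and the combination is convex for time
    steps below [tau_CFL] ([new_sqr_le]).  Both the convexity and the balance of
    the squares ([face_balance]) require that the signed integrals [N e] over
    the boundary of each cell sum up to zero ([face_speed_conservation]).

    This last fact rests on the geometry of the cells.  By Fubini's theorem on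
    the product mesh it follows from [closed_surface]: the normals of the faces
    of a polytopal set, weighted by the areas, sum up to zero.  It is a
    divergence theorem for constant fields, and it is proved one coordinate axis
    at a time by counting the crossings of the lines parallel to the axis:
    almost every such line avoids the ridges and leaves the set as often as it
    enters it ([exits_entries]), and the area of a face times the entry of its
    normal is the signed measure of the set of the lines that cross it
    ([cylinder_shadow]). *)

(** * Lebesgue measure on row vectors *)

Definition box (R : realType) n (A : 'I_n -> set R) : set 'rV[R]_n :=
  [set x | forall i, A i (x 0 i)].

Definition ins (R : realType) n (k : 'I_n.+1) (t : R) (y : 'rV[R]_n) :
    'rV[R]_n.+1 :=
  \row_i if unlift k i is Some j then y 0 j else t.

Lemma ins_id (R : realType) n (k : 'I_n.+1) (t : R) (y : 'rV[R]_n) :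
  ins k t y 0 k = t.
Proof. by rewrite mxE unlift_none. Qed.

Lemma ins_lift (R : realType) n (k : 'I_n.+1) (t : R) (y : 'rV[R]_n) j :
  ins k t y 0 (lift k j) = y 0 j.
Proof. by rewrite mxE liftK. Qed.

Lemma ins_col' (R : realType) n (k : 'I_n.+1) (x : 'rV[R]_n.+1) :
  ins k (x 0 k) (col' k x) = x.
Proof.
by apply/rowP => i; rewrite !mxE; case: unliftP => [j ->|->//]; rewrite mxE.
Qed.

Lemma prode_lty (R : realType) n (f : 'I_n -> \bar R) :
  (forall i, 0 <= f i < +oo)%E -> (0 <= \prod_(i < n) f i < +oo)%E.
Proof.
move=> fP; apply: (@big_ind _ (fun x : \bar R => 0 <= x < +oo)%E) => //.
  by rewrite lee01 ltry.
move=> x y /andP[x0 xoo] /andP[y0 yoo].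
by rewrite mule_ge0//= lte_mul_pinfty// ge0_fin_numE.
Qed.

Lemma measurable_box (R : realType) n (A : 'I_n -> set R) :
  (forall i, measurable (A i)) -> measurable (box A).
Proof.
move=> mA; rewrite (_ : box A = \bigcap_(i in [set: 'I_n])
    ((fun x : 'rV[R]_n => x 0 i) @^-1` A i)); last first.
  by apply/seteqP; split => x Ax i; [move=> _; exact: (Ax i)|exact: (Ax i I)].
apply: fin_bigcap_measurable; first exact: finite_finset.
by move=> i _; rewrite -[X in measurable X]setTI; exact: measurable_coord.
Qed.

Lemma lebesgue_rV_box (R : realType) n (A : 'I_n -> set R) :
  (forall i, measurable (A i)) ->
  lebesgue_rV R n (box A) = (\prod_(i < n) lebesgue_measure (A i))%E.
Proof.
elim: n A => [|n IHn] A mA.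
  rewrite big_ord0 /= diracE mem_set//.
  by case.
rewrite big_ord_recl -IHn//= /vcons_measure /pushforward.
rewrite (_ : vcons @^-1` box A =
    A ord0 `*` box (fun i => A (lift ord0 i))).
  rewrite product_measure1E; [by []|exact: mA|].
  by apply: measurable_box => i; exact: mA.
apply/seteqP; split => [[t y] /= Aty|[t y] /= [At Ay] i].
  split; first by have := Aty ord0; rewrite /vcons mxE unlift_none.
  by move=> i; have := Aty (lift ord0 i); rewrite /vcons mxE liftK.
by rewrite /vcons mxE; case: unliftP => [j ->|->//]; exact: Ay.
Qed.

(** Boxes form a pi-system that generates the sigma-algebra of the coordinates.
    This is how Tonelli along every axis and translation invariance reduce to
    the real line. *)
Lemma lebesgue_rV_unique (R : realType) n
    (m : {measure set 'rV[R]_n -> \bar R}) :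
  (forall A : 'I_n -> set R, (forall i, measurable (A i)) ->
     m (box A) = (\prod_(i < n) lebesgue_measure (A i))%E) ->
  forall S, measurable S -> lebesgue_rV R n S = m S.
Proof.
move=> mE S mS.
pose G : set (set 'rV[R]_n) :=
  [set box A | A in [set A : 'I_n -> set R | forall i, measurable (A i)]].
pose I k : set R := `[- k%:R, k%:R]%classic.
apply: (measure_unique G (fun k : nat => box (fun=> I k))) => //.
- apply/seteqP; split.
    apply: smallest_sub; first exact: smallest_sigma_algebra.
    rewrite -bigcup_seq; apply: bigcup_sub => i _ _ [B mB <-] /=.
    apply: sub_sigma_algebra.
    exists (fun j => if j == i then B else setT) => /=.
      by move=> j; case: ifP.
    apply/seteqP; split => x /=.
      by move=> /(_ i); rewrite eqxx; split.
    by move=> [_ Bx] j; case: eqP => // ->.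
  apply: smallest_sub; first exact: sigma_algebra_measurable.
  by move=> _ [A mA <-]; exact: measurable_box.
- move=> _ _ [A mA <-] [B mB <-]; exists (fun i => A i `&` B i).
    by move=> i; exact: measurableI.
  apply/seteqP; split => x /=; first by move=> AB; split=> i; have [] := AB i.
  by move=> [Ax Bx] i; split; [exact: Ax|exact: Bx].
- by move=> k; exists (fun=> I k) => // i; exact: measurable_itv.
- rewrite -subTset => x _; pose N i := (Num.truncn `|(x : 'rV[R]_n) 0 i|).+1.
  exists (\max_i N i)%N => // i; rewrite /I /= in_itv/= -ler_norml.
  by rewrite (le_trans (ltW (truncnS_gt _)))// ler_nat (leq_bigmax i).
- move=> _ [A mA <-]; exact: etrans (lebesgue_rV_box mA) (esym (mE _ mA)).
- move=> k.
  have /= -> := @lebesgue_rV_box R n (fun=> I k) (fun=> measurable_itv _).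
  suff /andP[] : (0 <= \prod_(i < n) lebesgue_measure (I k) < +oo)%E by [].
  apply: prode_lty => i.
  by rewrite measure_ge0/= lebesgue_measure_itv/=; case: ifP => // _;
    rewrite -EFinB ltry.
Qed.

(** The measure is built by adding leading coordinates, but its values on boxes
    do not distinguish the coordinates. *)
Lemma lebesgue_rV_ins (R : realType) n (k : 'I_n.+1) (S : set 'rV[R]_n.+1) :
  measurable S -> lebesgue_rV R n.+1 S =
  (lebesgue_measure \x lebesgue_rV R n)%E [set p | S (ins k p.1 p.2)].
Proof.
move=> mS; have mins : measurable_fun [set: R * 'rV[R]_n]
    (fun p => ins k p.1 p.2).
  apply: measurable_fun_rV => i; rewrite /ins.
  under eq_fun do rewrite mxE.
  case: unliftP => [j _|_]; last exact: measurable_fst.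
  by apply: (measurableT_comp (measurable_coord j)).
have := @lebesgue_rV_unique R n.+1
  (@pushforward _ _ _ _ _ (lebesgue_measure \x lebesgue_rV R n)%E
     (fun p => ins k p.1 p.2)).
move=> /(_ mins); apply => // A mA; rewrite /= /pushforward.
rewrite (_ : _ @^-1` _ = A k `*` box (fun j => A (lift k j))).
  rewrite product_measure1E; [|exact: mA|]; last first.
    by apply: measurable_box => j; exact: mA.
  by rewrite lebesgue_rV_box// (bigD1_ord k).
apply/seteqP; split => [[t y] /= Aty|[t y] /= [At Ay] i].
  split; first by have := Aty k; rewrite ins_id.
  by move=> j; have := Aty (lift k j); rewrite ins_lift.
by rewrite mxE; case: unliftP => [j ->|->//]; exact: Ay.
Qed.

Lemma lebesgue_measure_affine (R : realType) (a b : R) (S : set R) :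
  a != 0 -> measurable S ->
  lebesgue_measure S =
  (`|a|%:E * lebesgue_measure [set t : R | S (a * t + b)%R])%E.
Proof.
move=> a0 mS.
have mf : measurable_fun [set: measurableTypeR R]
    (fun t : R => a * t + b : measurableTypeR R).
  by apply: measurable_funD => //; apply: measurable_funM.
have := @lebesgue_measure_unique R (@mscale _ _ R (NngNum (normr_ge0 a))
  (@pushforward _ _ _ _ _ lebesgue_measure
    (fun t : R => a * t + b : measurableTypeR R))).
move=> /(_ mf) -> // _ [[x y] _ <-]; rewrite /= /mscale /= /pushforward.
have [a_lt0|a_gt0|/eqP] := ltrgtP a 0; last by rewrite (negbTE a0).
- rewrite (_ : _ @^-1` _ = `[(y - b) / a, (x - b) / a[%classic); last first.
    apply/seteqP; split => t /=; rewrite !in_itv/=.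
      rewrite ler_ndivrMr// ltr_ndivlMr// => /andP[? ?].
      by apply/andP; split; lra.
    rewrite ler_ndivrMr// ltr_ndivlMr// => /andP[? ?].
    by apply/andP; split; lra.
  rewrite !lebesgue_measure_itv/= !lte_fin ltr_nM2r ?invr_lt0// ltrD2r.
  case: ifP => xy; last by rewrite mule0.
  by rewrite -!EFinB -EFinM; congr EFin; rewrite ltr0_norm//; field.
- rewrite (_ : _ @^-1` _ = `](x - b) / a, (y - b) / a]%classic); last first.
    apply/seteqP; split => t /=; rewrite !in_itv/=.
      rewrite ler_pdivlMr// ltr_pdivrMr// => /andP[? ?].
      by apply/andP; split; lra.
    rewrite ler_pdivlMr// ltr_pdivrMr// => /andP[? ?].
    by apply/andP; split; lra.
  rewrite !lebesgue_measure_itv/= !lte_fin ltr_pM2r ?invr_gt0// ltrD2r.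
  case: ifP => xy; last by rewrite mule0.
  by rewrite -!EFinB -EFinM; congr EFin; rewrite gtr0_norm//; field.
Qed.

Lemma lebesgue_rV_shift (R : realType) n (u : 'rV[R]_n) (S : set 'rV[R]_n) :
  measurable S -> lebesgue_rV R n [set x | S (x + u)] = lebesgue_rV R n S.
Proof.
move=> mS; have mf : measurable_fun [set: 'rV[R]_n] (fun x => x + u).
  apply: measurable_fun_rV => i; under eq_fun do rewrite mxE.
  by apply: measurable_funD => //; exact: measurable_coord.
have := @lebesgue_rV_unique R n
  (@pushforward _ _ _ _ _ (lebesgue_rV R n) (fun x => x + u)).
move=> /(_ mf) uniq; apply/esym/uniq => // A mA; rewrite /= /pushforward.
rewrite (_ : _ @^-1` _ = box (fun i => [set t | A i (t + u 0 i)])).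
  rewrite lebesgue_rV_box.
    apply: eq_bigr => i _.
    rewrite (@lebesgue_measure_affine _ 1 (u 0 i) (A i))//.
    rewrite normr1 mul1e; congr lebesgue_measure.
    by apply/funext => t /=; rewrite mul1r.
  move=> i; rewrite -[X in measurable X]setTI.
  by apply: measurable_funD => //; exact: measurable_cst.
by apply/seteqP; split => x /= Ax i; have := Ax i; rewrite mxE.
Qed.

(** An open set is the union of the rational boxes that it contains. *)
Lemma open_rV_measurable (R : realType) n (A : set 'rV[R]_n) :
  open A -> measurable A.
Proof.
move=> oA.
pose B (p : 'rV[rat]_n * nat) : set 'rV[R]_n :=
  box (fun i =>
    `]ratr (p.1 0 i) - p.2.+1%:R^-1, ratr (p.1 0 i) + p.2.+1%:R^-1[%classic).
have -> : A = \bigcup_(p in [set p | B p `<=` A]) B p.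
  apply/seteqP; split; last by apply: bigcup_sub.
  move=> x Ax.
  have : nbhs x A by exact: open_nbhs_nbhs.
  move=> /nbhs_ballP[e /= e0 eA].
  have e2 : 0 < (e / 2)^-1 by rewrite invr_gt0 divr_gt0.
  pose k := Num.truncn (e / 2)^-1; have ke : k.+1%:R^-1 < e / 2.
    by rewrite -[ltRHS]invrK ltf_pV2 ?posrE// truncnS_gt.
  have qP i : exists q : rat, `|ratr q - x 0 i| < k.+1%:R^-1.
    have /rat_in_itvoo[q] : x 0 i - k.+1%:R^-1 < x 0 i + k.+1%:R^-1.
      by rewrite ltrD2l gtrN ?invr_gt0.
    by rewrite in_itv/= => qx; exists q; rewrite ltr_distl.
  exists (\row_i sval (cid (qP i)), k) => /=.
    move=> y By; apply: eA; split=> // i j; rewrite ord1.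
    move: (By j); rewrite /= in_itv/= mxE; case: (cid _) => q /= qx.
    rewrite -ltr_distl => qy; rewrite /ball/= -(subrK (ratr q) (x 0 j)) -addrA.
    rewrite (le_lt_trans (ler_normD _ _))// distrC (splitr e) ltrD//.
      exact: lt_trans ke.
    by rewrite distrC; exact: lt_trans ke.
  move=> i /=; rewrite in_itv/= mxE; case: (cid _) => q /= qx.
  by rewrite -ltr_distl distrC.
rewrite bigcup_mkcond; apply: countable_bigcupT_measurable => // p.
case: ifP => // _; apply: measurable_box => i; exact: measurable_itv.
Qed.

Lemma open_lebesgue_gt0 (R : realType) n (A : set 'rV[R]_n) :
  open A -> A !=set0 -> (0 < lebesgue_rV R n A)%E.
Proof.
move=> oA [x Ax].
have /nbhs_ballP[e /= e0 eA] : nbhs x A by exact: open_nbhs_nbhs.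
pose I i := `]x 0 i - e, x 0 i + e[%classic : set R.
have mI i : measurable (I i) by exact: measurable_itv.
apply: (@lt_le_trans _ _ (lebesgue_rV R n (box I))); last first.
  apply: le_measure; rewrite ?inE; [exact: measurable_box|
    exact: open_rV_measurable|].
  move=> y Iy; apply: eA; split=> // i j; rewrite ord1 /ball/=.
  by have := Iy j; rewrite /I/= in_itv/= -ltr_distl distrC.
rewrite lebesgue_rV_box//.
apply: (@big_ind _ (fun z : \bar R => 0 < z)%E) => //.
- by move=> a b; exact: mule_gt0.
- move=> i _; rewrite lebesgue_measure_itv/= lte_fin ltrD2l gtrN// -EFinB.
  by rewrite lte_fin; lra.
Qed.

Lemma measurable_fun_open_rV (R : realType) n (D : set 'rV[R]_n)
    (f : 'rV[R]_n -> R) :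
  open D -> {in D, continuous f} -> measurable_fun D f.
Proof.
move=> oD cf mD; apply: (measurability _ (RGenOInfty.measurableE R)) => //.
move=> _ [_ [a ->] <-]; apply: open_rV_measurable.
rewrite openE => x [Dx /=]; rewrite in_itv/= andbT => ax.
apply: filterI; first exact: open_nbhs_nbhs.
have : nbhs (f x) `]a, +oo[%classic.
  apply: open_nbhs_nbhs; split; first exact: interval_open.
  by rewrite /= in_itv/= ax.
by move=> /(cf x (mem_set Dx)).
Qed.

(** * Hyperplanes and areas of planar sets *)

Lemma dot_ins (R : realType) n (k : 'I_n.+1) (u : 'rV[R]_n.+1) t y :
  dot u (ins k t y) = u 0 k * t + dot (col' k u) y.
Proof.
rewrite /dot (bigD1_ord k)//= ins_id; congr (_ + _).
by apply: eq_bigr => i _; rewrite ins_lift mxE.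
Qed.

Lemma dotDr (R : realType) n (u x y : 'rV[R]_n) :
  dot u (x + y) = dot u x + dot u y.
Proof.
by rewrite /dot -big_split; apply: eq_bigr => i _; rewrite mxE mulrDr.
Qed.

Lemma dotZr (R : realType) n (u x : 'rV[R]_n) a : dot u (a *: x) = a * dot u x.
Proof.
by rewrite /dot mulr_sumr; apply: eq_bigr => i _; rewrite mxE mulrCA.
Qed.

Lemma dotDl (R : realType) n (u v x : 'rV[R]_n) :
  dot (u + v) x = dot u x + dot v x.
Proof.
by rewrite /dot -big_split; apply: eq_bigr => i _; rewrite mxE mulrDl.
Qed.

Lemma dotZl (R : realType) n (u x : 'rV[R]_n) a : dot (a *: u) x = a * dot u x.
Proof.
by rewrite /dot mulr_sumr; apply: eq_bigr => i _; rewrite mxE mulrA.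
Qed.

Lemma dotNr (R : realType) n (u x : 'rV[R]_n) : dot u (- x) = - dot u x.
Proof. by rewrite -scaleN1r dotZr mulN1r. Qed.

Lemma dotNl (R : realType) n (u x : 'rV[R]_n) : dot (- u) x = - dot u x.
Proof.
by rewrite /dot -sumrN; apply: eq_bigr => i _; rewrite mxE mulNr.
Qed.

Lemma dot0l (R : realType) n (x : 'rV[R]_n) : dot 0 x = 0.
Proof. by rewrite /dot big1// => i _; rewrite mxE mul0r. Qed.

Lemma dot_eq1_neq0 (R : realType) n (u : 'rV[R]_n) : dot u u = 1 -> u != 0.
Proof.
by move=> u1; apply/eqP => u0; move/eqP: u1; rewrite u0 dot0l eq_sym oner_eq0.
Qed.

Lemma measurable_dot (R : realType) n (u : 'rV[R]_n) :
  measurable_fun [set: 'rV[R]_n] (dot u).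
Proof.
apply: measurable_sum => i; apply: measurable_funM; first exact: measurable_cst.
exact: measurable_coord.
Qed.

Lemma measurable_hyperplane (R : realType) n (h : 'rV[R]_n * R) :
  measurable (hyperplane h).
Proof.
rewrite (_ : hyperplane h = dot h.1 @^-1` [set h.2]); last by [].
by rewrite -[X in measurable X]setTI; apply: measurable_dot.
Qed.

Lemma measurable_ins (R : realType) d (T : measurableType d) n (k : 'I_n.+1)
    (s : T -> R) (y : T -> 'rV[R]_n) :
  measurable_fun [set: T] s -> measurable_fun [set: T] y ->
  measurable_fun [set: T] (fun x => ins k (s x) (y x)).
Proof.
move=> ms my; apply: measurable_fun_rV => i.
under eq_fun do rewrite mxE.
case: unliftP => [j _|_] //.
exact: (measurableT_comp (measurable_coord j)).
Qed.

Lemma measurable_ins_preimage (R : realType) n (k : 'I_n.+1) S :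
  measurable S -> measurable [set p : R * 'rV[R]_n | S (ins k p.1 p.2)].
Proof.
move=> mS.
have := measurable_ins k (@measurable_fst _ _ R 'rV[R]_n) measurable_snd.
by move=> /(_ measurableT S mS); rewrite setTI.
Qed.

Definition shadow (R : realType) n (k : 'I_n.+1) (f : set 'rV[R]_n.+1) :
    set 'rV[R]_n :=
  [set y | exists t, f (ins k t y)].

(** The part of the domain of [surface_integral] in the factor that contains the
    planar set. *)
Definition cylinder (R : realType) d (h : 'rV[R]_d * R) (f : set 'rV[R]_d) :
    set 'rV[R]_d :=
  [set x | 0 < dot h.1 x - h.2 < 1 /\ f (x - (dot h.1 x - h.2) *: h.1)].

Lemma product_measure_ysection (R : realType) d1 d2
    (T1 : measurableType d1) (T2 : measurableType d2)
    (m1 : {sigma_finite_measure set T1 -> \bar R})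
    (m2 : {sigma_finite_measure set T2 -> \bar R}) (A : set (T1 * T2)) :
  measurable A -> (m1 \x m2)%E A = (\int[m2]_y m1 (ysection A y))%E.
Proof.
move=> mA.
have -> // := @product_measure_unique _ _ _ _ _ m1 m2 (m1 \x^ m2)%E.
by move=> *; exact: product_measure2E.
Qed.

Lemma hyperplane_null (R : realType) n (h : 'rV[R]_n * R) :
  h.1 != 0 -> lebesgue_rV R n (hyperplane h) = 0%E.
Proof.
case: n h => [|n] h h0; first by rewrite thinmx0 eqxx in h0.
have [k hk] : exists k, h.1 0 k != 0.
  apply/existsP; apply: contraR h0; rewrite negb_exists => /forallP hk.
  by apply/eqP/rowP => k; rewrite mxE; apply/eqP/negPn/hk.
rewrite (lebesgue_rV_ins k); last exact: measurable_hyperplane.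
rewrite product_measure_ysection; last first.
  apply: (@measurable_ins_preimage _ _ k (hyperplane h)).
  exact: measurable_hyperplane.
rewrite integral0_eq// => y _.
rewrite (_ : ysection _ _ = [set (h.2 - dot (col' k h.1) y) / h.1 0 k]).
  exact: lebesgue_measure_set1.
apply/seteqP; split => t; rewrite /ysection/= inE/= /hyperplane/= dot_ins.
  by move=> <-; rewrite addrK mulrAC divff// mul1r.
by move=> ->; rewrite mulrC divfK// subrK.
Qed.

Lemma shadowE (R : realType) n (k : 'I_n.+1) (h : 'rV[R]_n.+1 * R) f :
  h.1 0 k != 0 -> f `<=` hyperplane h ->
  shadow k f = [set y | f (ins k ((h.2 - dot (col' k h.1) y) / h.1 0 k) y)].
Proof.
move=> hk fh; apply/seteqP; split => y /=; last first.
  by move=> ft; eexists; exact: ft.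
move=> [t ft].
suff -> : (h.2 - dot (col' k h.1) y) / h.1 0 k = t by [].
have := fh _ ft; rewrite /hyperplane/= dot_ins => <-.
by rewrite addrK mulrAC divff// mul1r.
Qed.

Lemma measurable_shadow (R : realType) n (k : 'I_n.+1) (h : 'rV[R]_n.+1 * R) f :
  h.1 0 k != 0 -> f `<=` hyperplane h -> measurable f ->
  measurable (shadow k f).
Proof.
move=> hk fh mf; rewrite (shadowE hk fh).
have ms : measurable_fun [set: 'rV[R]_n]
    (fun y => (h.2 - dot (col' k h.1) y) / h.1 0 k).
  apply: measurable_funM; last exact: measurable_cst.
  by apply: measurable_funB; [exact: measurable_cst|exact: measurable_dot].
have := measurable_ins k ms (@measurable_id _ _ [set: 'rV[R]_n]).
by move=> /(_ measurableT f mf); rewrite setTI.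
Qed.

Lemma measurable_cylinder (R : realType) n (h : 'rV[R]_n * R) f :
  measurable f -> measurable (cylinder h f).
Proof.
move=> mf.
rewrite (_ : cylinder h f = (dot h.1 @^-1` `]h.2, h.2 + 1[%classic) `&`
   ((fun x => x - (dot h.1 x - h.2) *: h.1) @^-1` f)); last first.
  by apply/seteqP; split => p; rewrite /cylinder/= in_itv/= subr_gt0 ltrBlDl.
apply: measurableI; rewrite -[X in measurable X]setTI.
  by apply: measurable_dot => //; exact: measurable_itv.
apply: (@measurable_fun_rV R _ _ n) => // i.
under eq_fun do rewrite !mxE.
apply: measurable_funB; first exact: measurable_coord.
apply: measurable_funM; last exact: measurable_cst.
by apply: measurable_funB; [exact: measurable_dot|exact: measurable_cst].
Qed.

(** The volume of the cylinder is the area of [f], and the shadow is smaller by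
    the cosine of the angle between the normal and the axis of projection.  In
    the coordinates given by the height over the plane and by the entries other
    than the [k]-th, the cylinder is a sheared product of the unit interval and
    the shadow; the change of coordinates scales volumes by the [k]-th entry of
    the normal. *)
Lemma cylinder_shadow (R : realType) n (k : 'I_n.+1) (h : 'rV[R]_n.+1 * R) f :
  dot h.1 h.1 = 1 -> h.1 0 k != 0 -> f `<=` hyperplane h -> measurable f ->
  (`|h.1 0 k|%:E * lebesgue_rV R n.+1 (cylinder h f) =
  lebesgue_rV R n (shadow k f))%E.
Proof.
move=> h1 hk fh mf.
set n' := col' k h.1.
have mS := measurable_shadow hk fh mf.
(* [Q] is the cylinder with the height over the plane as first coordinate. *)
pose Q := [set p : R * 'rV[R]_n | 0 < p.1 < 1 /\ shadow k f (p.2 - p.1 *: n')].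
have mQ : measurable Q.
  rewrite (_ : Q = (fst @^-1` `]0, 1[%classic) `&`
                   ((fun p => p.2 - p.1 *: n') @^-1` shadow k f)); last first.
    by apply/seteqP; split => p; rewrite /Q/= in_itv.
  apply: measurableI; rewrite -[X in measurable X]setTI.
    by apply: measurable_fst => //; exact: measurable_itv.
  apply: (@measurable_fun_rV R _ _ n) => // i.
  under eq_fun do rewrite !mxE.
  apply: measurable_funB.
    by apply: (measurableT_comp (measurable_coord i)).
  by apply: measurable_funM => //; exact: measurable_cst.
have mC := measurable_cylinder h mf.
rewrite (lebesgue_rV_ins k)// product_measure_ysection; last first.
  exact: (@measurable_ins_preimage _ _ k (cylinder h f)).
rewrite -ge0_integralZl//; last first.
  apply: measurable_fun_ysection.
  exact: (@measurable_ins_preimage _ _ k (cylinder h f)).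
transitivity (\int[lebesgue_rV R n]_y lebesgue_measure (ysection Q y))%E.
  apply: eq_integral => y _.
  rewrite [RHS](lebesgue_measure_affine (dot n' y - h.2) hk); last first.
    exact: measurable_ysection.
  congr (_ * lebesgue_measure _)%E; apply/seteqP.
  have E t : dot h.1 (ins k t y) - h.2 = h.1 0 k * t + (dot n' y - h.2).
    by rewrite dot_ins addrA.
  (* The foot of a point lies on the plane, where [f] is determined by its
     shadow. *)
  have eqf t : f (ins k t y - (dot h.1 (ins k t y) - h.2) *: h.1) <->
      shadow k f (y - (dot h.1 (ins k t y) - h.2) *: n').
    set r := _ - h.2.
    have Ei : ins k t y - r *: h.1 = ins k (t - r * h.1 0 k) (y - r *: n').
      apply/rowP => i; rewrite !mxE.
      by case: unliftP => [j ->|->]; rewrite ?mxE.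
    rewrite Ei; split; first by move=> ?; eexists; eassumption.
    move=> [t' ft']; suff -> : t - r * h.1 0 k = t' by [].
    have := fh _ ft'; rewrite /hyperplane/= dot_ins => Et'.
    have : dot h.1 (ins k t y - r *: h.1) = h.2.
      by rewrite dotDr dotNr dotZr h1 mulr1 /r; lra.
    by rewrite Ei dot_ins -Et' => /addIr /(mulfI hk).
  split => t; rewrite /ysection/= !inE/= /cylinder/Q/= -E.
    by move=> [? /eqf].
  by move=> [? /eqf].
rewrite -product_measure_ysection//= /product_measure1/=.
transitivity (\int[lebesgue_measure]_(x in `]0%R, 1%R[)
   lebesgue_rV R n (shadow k f))%E.
  rewrite [RHS]integral_mkcond; apply: eq_integral => r _.
  rewrite patchE mem_setE; case: ifPn => r01.
    rewrite -(lebesgue_rV_shift (- r *: n') mS); congr (lebesgue_rV R n _).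
    apply/seteqP; split => y; rewrite /xsection/= inE/= /Q/= scaleNr.
      by move=> [].
    by move: r01; rewrite in_itv/=.
  rewrite (_ : xsection _ _ = set0) ?measure0// -subset0 => y.
  rewrite /xsection/= inE/= /Q/= => -[r01'].
  by move: r01; rewrite in_itv/= r01'.
rewrite integral_cst//= lebesgue_measure_itv/= lte_fin ltr01 -EFinB subr0.
by rewrite mule1.
Qed.

(** * Lines through a polytopal set *)

Lemma coord_le_norm (R : realType) n (x : 'rV[R]_n) i : `|x 0 i| <= `|x|.
Proof.
rewrite [leRHS]/Num.norm/= mx_normrE.
exact: (le_bigmax _ (fun i : 'I_1 * 'I_n => `|x i.1 i.2|) (0, i)).
Qed.

Lemma bounded_lebesgue_rV (R : realType) n (A : set 'rV[R]_n) (M : R) :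
  measurable A -> (forall x i, A x -> `|x 0 i| <= M) ->
  (lebesgue_rV R n A < +oo)%E.
Proof.
move=> mA AM; pose I := `[- M, M]%classic : set R.
have mI : measurable I by exact: measurable_itv.
apply: (@le_lt_trans _ _ (lebesgue_rV R n (box (fun=> I)))).
  apply: le_measure; rewrite ?inE//; first exact: measurable_box.
  by move=> x Ax i; rewrite /I/= in_itv/= -ler_norml; exact: AM.
rewrite lebesgue_rV_box//.
suff /andP[] : (0 <= \prod_(i < n) lebesgue_measure I < +oo)%E by [].
apply: prode_lty => i.
by rewrite measure_ge0/= lebesgue_measure_itv/=; case: ifP => // _;
  rewrite -EFinB ltry.
Qed.

Lemma bounded_coord (R : realType) n (A : set 'rV[R]_n) :
  bounded_set A -> exists M, forall x i, A x -> `|x 0 i| <= M.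
Proof.
move=> [M [_ AM]]; exists (M + 1) => x i Ax.
by rewrite (le_trans (coord_le_norm _ _))//; apply: AM => //; rewrite ltrDl.
Qed.

Lemma ins_delta (R : realType) n (k : 'I_n.+1) (t : R) (y : 'rV[R]_n) :
  ins k t y = ins k 0 y + t *: delta_mx 0 k.
Proof.
apply/rowP => i; rewrite !mxE eqxx/=; case: unliftP => [j ->|->].
  by rewrite eq_sym (negbTE (neq_lift _ _)) mulr0 addr0.
by rewrite eqxx mulr1 add0r.
Qed.

Lemma continuous_ins (R : realType) n (k : 'I_n.+1) (y : 'rV[R]_n) :
  continuous (fun t : R => ins k t y).
Proof.
rewrite (_ : (fun t => _) = (fun t : R => ins k 0 y + t *: delta_mx 0 k)).
  by move=> t; apply: cvgD; [exact: cvg_cst|apply: cvgZr_tmp; exact: cvg_id].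
by apply/funext => t; exact: ins_delta.
Qed.

Lemma locally_constant (R : realType) (H : R -> R) :
  (forall t, \forall s \near t, H s = H t) -> forall s t, H s = H t.
Proof.
move=> Hc s t; apply: is_derive_0_is_cst => x.
apply: (@near_eq_is_derive _ _ _ (cst (H x))).
by apply: filterS (Hc x) => z ->.
Qed.

Lemma near_ltr (R : realType) (T t : R) : T != t ->
  \forall s \near t, ((T <= s) = (T <= t)) /\ ((T < s) = (T < t)).
Proof.
move=> Tt; have [tT|Tt'|/eqP] := ltrgtP t T; last by rewrite eq_sym (negbTE Tt).
- apply: filterS (lt_nbhsl tT) => s sT.
  by rewrite leNgt sT ltNge ltW.
- apply: filterS (lt_nbhsr Tt') => s sT.
  by rewrite sT ltW.
Qed.

(** A line in direction [k] that meets a subspace of codimension two satisfies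
    the linear combination of the two equations in which the [k]-th coordinate
    cancels, so such lines are exceptional. *)
Lemma ridge_shadow (R : realType) n (k : 'I_n.+1) (L : set 'rV[R]_n.+1) :
  codim2_affine L ->
  exists2 g : 'rV[R]_n * R, g.1 != 0 & shadow k L `<=` hyperplane g.
Proof.
move=> [h1 [h2 [free12 ->]]].
have col'_eq0 (u : 'rV[R]_n.+1) : u 0 k = 0 -> col' k u = 0 -> u = 0.
  move=> uk /rowP u0; rewrite -(ins_col' k u) uk.
  apply/rowP => i; rewrite mxE [RHS]mxE; case: unliftP => // j _.
  by rewrite u0 mxE.
have indep (a b : R) : a *: h1.1 + b *: h2.1 = 0 -> a = 0 /\ b = 0.
  move=> ab0; have : row_mx a%:M b%:M *m col_mx h1.1 h2.1 = 0.
    by rewrite mul_row_col !mul_scalar_mx.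
  rewrite -[RHS](mul0mx _ (col_mx h1.1 h2.1)) => /(row_free_inj free12).
  rewrite -row_mx0 => /eq_row_mx[/matrixP/(_ 0 0) + /matrixP/(_ 0 0)].
  by rewrite !mxE eqxx !mulr1n.
pose a := h2.1 0 k; pose b := h1.1 0 k.
have [/andP[/eqP a0 /eqP b0]|ab] := boolP ((a == 0) && (b == 0)).
  exists (col' k h1.1, h1.2) => /=.
    apply/eqP => /(col'_eq0 _ b0) h10.
    have [|/eqP] := indep 1 0; first by rewrite h10 scaler0 scale0r addr0.
    by rewrite oner_eq0.
  by move=> y [t [+ _]]; rewrite /hyperplane/= dot_ins -/b b0 mul0r add0r.
exists (a *: col' k h1.1 - b *: col' k h2.1, a * h1.2 - b * h2.2) => /=.
  apply: contra ab => /eqP ab0.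
  have : a *: h1.1 - b *: h2.1 = 0.
    apply: col'_eq0; first by rewrite !mxE -/a -/b mulrC subrr.
    by rewrite -ab0; apply/rowP => i; rewrite !mxE.
  rewrite -scaleNr => /indep[-> /eqP]; rewrite oppr_eq0 => ->.
  by rewrite eqxx.
move=> y [t []]; rewrite /hyperplane/= !dot_ins -/a -/b => <- <-.
rewrite dotDl dotNl !dotZl; ring.
Qed.

Lemma outward_line (R : realType) n (k : 'I_n.+1) (K : set 'rV[R]_n.+1) nu y t :
  outward_normal K (ins k t y) nu ->
  \forall s \near t, K (ins k s y) <-> nu 0 k * (s - t) < 0.
Proof.
move=> out; have outt : \forall s \near t,
    K (ins k s y) <-> dot nu (ins k s y - ins k t y) < 0.
  exact: (@continuous_ins R n k y t _ out).
apply: filterS outt => s ->.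
by rewrite dotDr dotNr !dot_ins opprD addrACA subrr addr0 mulrBr.
Qed.

(** A line that meets the boundary of a bounded open set only at flat points,
    and never tangentially, leaves the set as often as it enters it.  Along the
    line, the indicator of the set plus the number of exits so far minus the
    number of entries so far is locally constant, hence constant, and far away
    in both directions the line is outside of the set. *)
Lemma exits_entries (R : realType) n (k : 'I_n.+1) (K : set 'rV[R]_n.+1)
    (I : finType) (P : pred I) (f : I -> set 'rV[R]_n.+1)
    (h : I -> 'rV[R]_n.+1 * R) (sigma : I -> R) (y : 'rV[R]_n) :
  open K -> bounded_set K -> trivIset setT f ->
  (forall i, P i -> f i `<=` hyperplane (h i)) ->
  (forall i x, P i -> f i x -> outward_normal K x (sigma i *: (h i).1)) ->
  (forall i, P i -> sigma i = 1 \/ sigma i = -1) ->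
  (forall t, boundary K (ins k t y) -> exists2 i, P i & f i (ins k t y)) ->
  (forall i, P i -> (h i).1 0 k = 0 -> ~ shadow k (f i) y) ->
  \sum_(i | P i) Num.sg (sigma i * (h i).1 0 k) * \1_(shadow k (f i)) y = 0.
Proof.
move=> oK bK tf fh fnu sg1 bdry Ny.
pose a i := sigma i * (h i).1 0 k.
pose T i := ((h i).2 - dot (col' k (h i).1) y) / (h i).1 0 k.
have hitT i t : P i -> f i (ins k t y) -> (h i).1 0 k != 0 /\ t = T i.
  move=> Pi fi; have hk : (h i).1 0 k != 0.
    by apply/eqP => hk0; apply: (Ny _ Pi hk0); exists t.
  split=> //; rewrite /T; have := fh _ Pi _ fi.
  by rewrite /hyperplane/= dot_ins => <-; rewrite addrK mulrAC divff// mul1r.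
(* The point of crossing itself is outside of the open set, so that an exit is
   counted from its time on, but an entry only after its time. *)
pose phi i t : R := \1_(shadow k (f i)) y *
  (if 0 < a i then (T i <= t)%R%:R else - (T i < t)%R%:R).
pose inK t : R := \1_K (ins k t y).
pose H t := inK t + \sum_(i | P i) phi i t.
have phi_near i t : T i != t -> \forall s \near t, phi i s = phi i t.
  by move=> /near_ltr; apply: filterS => s [le lt]; rewrite /phi le lt.
have H_near t : \forall s \near t, H s = H t.
  have [[i0 Pi0 fi0]|nof] := pselect (exists2 i, P i & f i (ins k t y)).
    have [hk tT] := hitT _ _ Pi0 fi0.
    have ai0 : a i0 != 0.
      by rewrite /a mulf_neq0//; case: (sg1 _ Pi0) => ->;
        rewrite ?oppr_eq0 oner_eq0.
    have near_i0 : \forall s \near t, inK s + phi i0 s = inK t + phi i0 t.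
      have yi0 : y \in shadow k (f i0) by rewrite inE; exists t.
      have /outward_line := fnu _ _ Pi0 fi0; rewrite mxE -/(a i0) => nearK.
      have inKE s : (K (ins k s y) <-> a i0 * (s - t) < 0) ->
          inK s = (a i0 * (s - t) < 0)%R%:R.
        move=> Ks; rewrite /inK indicE; congr ((nat_of_bool _)%:R).
        apply/idP/idP.
          by rewrite inE => /Ks.
        by move=> /Ks ?; rewrite inE.
      have inKt := inKE _ (nbhs_singleton nearK).
      apply: filterS nearK => s /inKE ->; rewrite inKt /phi indicE yi0 -tT.
      rewrite subrr mulr0 !ltxx lexx !mul1r.
      have [a_lt0|a_gt0|/eqP] := ltrgtP (a i0) 0; last by rewrite (negbTE ai0).
        rewrite nmulr_rlt0// subr_gt0; case: (t < s); rewrite /=; ring.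
      rewrite pmulr_rlt0// subr_lt0 ltNge; case: (t <= s); rewrite /=; ring.
    have near_others : \forall s \near t,
        forall i, (P i && (i != i0)) -> phi i s = phi i t.
      apply: (@filter_forall _ I
        (fun i s => P i && (i != i0) -> phi i s = phi i t)
        (nbhs t) (nbhs_filter t)) => i.
      have [/andP[Pi ii0]|_] := boolP (P i && (i != i0)); last exact: nearW.
      have [yi|yi] := boolP (y \in shadow k (f i)); last first.
        by apply: nearW => s _; rewrite /phi indicE (negbTE yi) !mul0r.
      suff Tit : T i != t by apply: filterS (phi_near _ _ Tit) => s ->.
      apply/eqP => Tit; move: yi; rewrite inE => -[t' ft'].
      have [_ t'T] := hitT _ _ Pi ft'.
      move/trivIsetP : tf => /(_ i i0 Logic.I Logic.I ii0).
      rewrite t'T Tit in ft'.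
      by rewrite -subset0 => /(_ _ (conj ft' fi0)).
    near=> s.
    rewrite /H (bigD1 i0)//= [in RHS](bigD1 i0)//= !addrA; congr (_ + _).
      by near: s.
    by apply: eq_bigr => i Pi; move: i Pi; near: s.
  have inK_near : \forall s \near t, inK s = inK t.
    have : ~ boundary K (ins k t y) by move=> /bdry.
    rewrite /boundary => nb.
    have [Kt|nKt] := pselect (K (ins k t y)).
      have : nbhs (ins k t y) K by exact: open_nbhs_nbhs.
      move=> /(@continuous_ins R n k y t) nearK.
      have {}nearK : \forall s \near t, K (ins k s y) by exact: nearK.
      by apply: filterS nearK => s Ks; rewrite /inK !indicE !mem_set.
    have : nbhs (ins k t y) (~` K).
      apply: (@filterS _ _ _ (~` closure K)).
        by apply: subsetC; exact: subset_closure.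
      apply: open_nbhs_nbhs; split.
        exact: closed_openC (@closed_closure _ K).
      by move=> cK; apply: nb; split=> // /interior_subset.
    move=> /(@continuous_ins R n k y t) nearK.
    have {}nearK : \forall s \near t, ~ K (ins k s y) by exact: nearK.
    by apply: filterS nearK => s Ks; rewrite /inK !indicE !memNset.
  have near_phi : \forall s \near t, forall i, P i -> phi i s = phi i t.
    apply: (@filter_forall _ I (fun i s => P i -> phi i s = phi i t)
      (nbhs t) (nbhs_filter t)) => i.
    have [Pi|_] := boolP (P i); last exact: nearW.
    have [yi|yi] := boolP (y \in shadow k (f i)); last first.
      by apply: nearW => s _; rewrite /phi indicE (negbTE yi) !mul0r.
    suff Tit : T i != t by apply: filterS (phi_near _ _ Tit) => s ->.
    apply/eqP => Tit; move: yi; rewrite inE => -[t' ft'].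
    have [_ t'T] := hitT _ _ Pi ft'.
    by rewrite t'T Tit in ft'; apply: nof; exists i.
  near=> s; rewrite /H; congr (_ + _); first by near: s.
  by apply: eq_bigr => i Pi; move: i Pi; near: s.
have [M KM] := bounded_coord bK.
(* All crossings happen between the times [- t1] and [t1]. *)
pose t1 := `|M| + \sum_i `|T i| + 1.
have T_le i : `|T i| <= \sum_j `|T j|.
  by rewrite (bigD1 i)//= lerDl sumr_ge0.
have M0 : 0 <= \sum_i `|T i| by rewrite sumr_ge0.
have Kout t : `|M| < `|t| -> inK t = 0.
  move=> Mt; rewrite /inK indicE memNset// => /(KM _ k); rewrite ins_id.
  by have := ler_norm M; lra.
have t1_gt0 : 0 < t1 by rewrite /t1; have := normr_ge0 M; lra.
have := locally_constant H_near t1 (- t1).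
have Mt1 : `|M| < t1 by rewrite /t1; lra.
rewrite /H (Kout t1) ?(gtr0_norm t1_gt0)//.
rewrite (Kout (- t1)) ?normrN ?(gtr0_norm t1_gt0)//.
rewrite !add0r [X in _ = X -> _]big1 => [phi1|i Pi]; last first.
  have Ti : - t1 < T i.
    by have := T_le i; rewrite ler_norml => /andP[? ?];
      have := normr_ge0 M; rewrite /t1; lra.
  by rewrite /phi (ltNge (T i)) (ltW Ti) (leNgt (T i)) Ti oppr0 if_same mulr0.
rewrite -[RHS]phi1; apply: eq_bigr => i Pi; rewrite mulrC /phi.
have Ti : T i < t1.
  by have := T_le i; rewrite ler_norml => /andP[? ?];
      have := normr_ge0 M; rewrite /t1; lra.
have [yi|yi] := boolP (y \in shadow k (f i)); last first.
  by rewrite indicE (negbTE yi) !mul0r.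
congr (_ * _); move: yi; rewrite inE => -[t' ft'].
have [hk _] := hitT _ _ Pi ft'.
have ai : a i != 0.
  by rewrite /a mulf_neq0//; case: (sg1 _ Pi) => ->; rewrite ?oppr_eq0 oner_eq0.
rewrite Ti ltW//= -/(a i).
by have [a_lt0|a_gt0|/eqP] := ltrgtP (a i) 0;
  [rewrite ltr0_sg|rewrite gtr0_sg|rewrite (negbTE ai)].
Unshelve. all: by end_near.
Qed.

(** * The surface of a polytopal set is closed *)

Lemma integrable_sum_EFin d (T : measurableType d) (R : realType)
    (mu : {measure set T -> \bar R}) (D : set T) (I : Type) (s : seq I)
    (P : pred I) (f : I -> T -> R) : measurable D ->
  (forall i, P i -> mu.-integrable D (EFin \o f i)) ->
  mu.-integrable D (EFin \o (fun x => \sum_(i <- s | P i) f i x)).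
Proof.
move=> mD fi.
rewrite (_ : _ \o _ = fun x => (\sum_(i <- s | P i) (EFin \o f i) x)%E).
  exact: integrable_sum.
by apply/funext => x /=; rewrite sumEFin.
Qed.

Lemma Rintegral_sum d (T : measurableType d) (R : realType)
    (mu : {measure set T -> \bar R}) (D : set T) (I : Type) (s : seq I)
    (P : pred I) (f : I -> T -> R) : measurable D ->
  (forall i, P i -> mu.-integrable D (EFin \o f i)) ->
  \int[mu]_(x in D) (\sum_(i <- s | P i) f i x) =
  \sum_(i <- s | P i) \int[mu]_(x in D) f i x.
Proof.
move=> mD fi; elim: s => [|i s IHs].
  rewrite big_nil; under eq_Rintegral do rewrite big_nil.
  by rewrite Rintegral_cst// mul0r.
rewrite big_cons; under eq_Rintegral do rewrite big_cons.
case: ifPn => // Pi; rewrite RintegralD ?IHs//; first exact: fi.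
exact: integrable_sum_EFin.
Qed.

Lemma negligible_finbigcup d (T : measurableType d) (R : realType)
    (mu : {measure set T -> \bar R}) (I : finType) (F : I -> set T) :
  (forall i, mu.-negligible (F i)) -> mu.-negligible (\bigcup_i F i).
Proof.
move=> nF; have -> : \bigcup_i F i = \big[setU/set0]_(i <- index_enum I) F i.
  rewrite -bigcup_seq; apply/seteqP; split => x [i _ Fx]; exists i => //=.
  exact: mem_index_enum.
by elim/big_ind : _ => // [|A B]; [exact: negligible_set0|exact: negligibleU].
Qed.

Lemma integrable_indic_lty d (T : measurableType d) (R : realType)
    (mu : {measure set T -> \bar R}) (A : set T) : measurable A ->
  (mu A < +oo)%E -> mu.-integrable setT (EFin \o (\1_A : T -> R)).
Proof.
move=> mA Aoo; apply/integrableP; split; first exact/measurable_EFinP.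
rewrite (eq_integral (fun x => (\1_A x)%:E)); last first.
  by move=> t _; rewrite /= ger0_norm// ler0n.
by rewrite integral_indic// setIT.
Qed.

Lemma hyperplane_negligible (R : realType) n (h : 'rV[R]_n * R) :
  h.1 != 0 -> (lebesgue_rV R n).-negligible (hyperplane h).
Proof.
move=> h0; apply/negligibleP; first exact: measurable_hyperplane.
exact: hyperplane_null.
Qed.

Lemma within_ridges_shadow (R : realType) n (k : 'I_n.+1)
    (S : set 'rV[R]_n.+1) :
  within_ridges S -> (lebesgue_rV R n).-negligible (shadow k S).
Proof.
move=> [r [L [Lcod SL]]].
apply: (@negligibleS _ _ _ _ (\bigcup_i shadow k (L i))).
  by move=> y [t /SL[i _ Lt]]; exists i => //; exists t.
apply: negligible_finbigcup => i.
have [g g0 Lg] := ridge_shadow k (Lcod i).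
exact: negligibleS Lg (hyperplane_negligible g0).
Qed.

Lemma col'_neq0 (R : realType) n (k : 'I_n.+1) (u : 'rV[R]_n.+1) :
  u != 0 -> u 0 k = 0 -> col' k u != 0.
Proof.
move=> u0 uk; apply: contra u0 => /eqP/rowP u'0; apply/eqP.
rewrite -(ins_col' k u) uk; apply/rowP => i; rewrite mxE [RHS]mxE.
by case: unliftP => // j _; rewrite u'0 mxE.
Qed.

Lemma outward_normal_closure (R : realType) n (K : set 'rV[R]_n) x nu :
  dot nu nu = 1 -> outward_normal K x nu -> closure K x.
Proof.
move=> nu1 out B xB.
have cl : continuous (fun s : R => x - s *: nu).
  by move=> s; apply: cvgB; [exact: cvg_cst|apply: cvgZr_tmp; exact: cvg_id].
have : nbhs (x - 0 *: nu)
    ([set z | K z <-> dot nu (z - x) < 0] `&` B).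
  by rewrite scale0r subr0; exact: filterI.
move=> /(cl 0)/nbhs_ballP[e /= e0 sub].
exists (x - (e / 2) *: nu); have [|Ks Bs] := sub (e / 2).
  rewrite /ball/= sub0r normrN gtr0_norm ?divr_gt0//.
  by rewrite ltr_pdivrMr// ltr_pMr// ltr1n.
split=> //; apply/Ks; rewrite addrAC subrr sub0r dotNr dotZr nu1 mulr1.
by rewrite oppr_lt0 divr_gt0.
Qed.

Lemma closure_coord (R : realType) n (K : set 'rV[R]_n) M x i :
  (forall z, K z -> `|z 0 i| <= M) -> closure K x -> `|x 0 i| <= M + 1.
Proof.
move=> KM /(_ (ball x 1) (nbhsx_ballx _ _ ltr01))[z [Kz [_ xz]]].
rewrite -(subrK (z 0 i) (x 0 i)) (le_trans (ler_normD _ _))// addrC lerD ?KM//.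
exact/ltW/xz.
Qed.

(** The divergence theorem for constant fields: a constant pressure exerts no
    net force on a closed surface.  For the component along the axis [k], the
    area of a face times the [k]-th entry of its normal is the signed area of
    its shadow.  The line over almost every point avoids the ridges and the
    faces parallel to the axis, hence crosses as many exit faces as entry
    faces, and it remains to integrate this identity over the base points. *)
Lemma closed_surface (R : realType) n (K : set 'rV[R]_n)
    (I : finType) (P : pred I) (f : I -> set 'rV[R]_n)
    (h : I -> 'rV[R]_n * R) (sigma : I -> R) :
  open K -> bounded_set K -> trivIset setT f ->
  (forall i, P i -> measurable (f i)) ->
  (forall i, P i -> dot (h i).1 (h i).1 = 1) ->
  (forall i, P i -> f i `<=` hyperplane (h i)) ->
  (forall i x, P i -> f i x -> outward_normal K x (sigma i *: (h i).1)) ->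
  (forall i, P i -> sigma i = 1 \/ sigma i = -1) ->
  within_ridges (boundary K `\` \bigcup_(i in [set i | P i]) f i) ->
  \sum_(i | P i) (sigma i * fine (lebesgue_rV R n (cylinder (h i) (f i)))) *:
    (h i).1 = 0.
Proof.
case: n K f h => [|n] K f h oK bK tf mf h1 fh fnu sg1 bdry; apply/rowP => k.
  by case: k.
rewrite summxE mxE.
pose Q i := P i && ((h i).1 0 k != 0).
pose c i := Num.sg (sigma i * (h i).1 0 k).
pose S i := shadow k (f i).
have mS i : Q i -> measurable (S i).
  move=> /andP[Pi hk]; apply: (measurable_shadow hk); [exact: fh|exact: mf].
have [M KM] := bounded_coord bK.
have Soo i : Q i -> (lebesgue_rV R n (S i) < +oo)%E.
  move=> Qi; apply: (@bounded_lebesgue_rV _ _ _ (M + 1)); first exact: mS.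
  move=> y j [t fy]; case/andP: (Qi) => Pi hk.
  rewrite -(ins_lift k t y j); apply: closure_coord => [z|]; first exact: KM.
  apply: outward_normal_closure (fnu _ _ Pi fy).
  rewrite dotZl dotZr h1//.
  by case: (sg1 _ Pi) => ->; rewrite !mulr1 ?mulrNN ?mulr1.
transitivity (\sum_(i | Q i) c i * fine (lebesgue_rV R n (S i))).
  rewrite [LHS](bigID (fun i => (h i).1 0 k != 0))/= [X in _ + X]big1.
    rewrite addr0; apply: eq_bigr => i /andP[Pi hk].
    rewrite -(cylinder_shadow (h1 _ Pi) hk (fh _ Pi) (mf _ Pi)).
    rewrite mxE /c sgrM.
    have -> : Num.sg (sigma i) = sigma i.
      by case: (sg1 _ Pi) => ->; rewrite ?sgrN sgr1.
    set A := lebesgue_rV R n.+1 _.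
    have -> : fine (`|(h i).1 0 k|%:E * A) = `|(h i).1 0 k| * fine A.
      have : (0 <= A)%E by exact: measure_ge0.
      case: A => [r _|_|]; [by []| |by rewrite leeNy_eq].
      by rewrite gt0_muley ?lte_fin ?normr_gt0//= mulr0.
    rewrite -/A {1}[(h i).1 0 k]numEsg; ring.
  by move=> i /andP[_ /negPn/eqP hk]; rewrite mxE hk mulr0.
have intS i : Q i ->
    (lebesgue_rV R n).-integrable setT (EFin \o (\1_(S i) : _ -> R)).
  by move=> Qi; apply: integrable_indic_lty; [exact: mS|exact: Soo].
have intcS i : Q i ->
    (lebesgue_rV R n).-integrable setT (EFin \o (fun y => c i * \1_(S i) y)).
  move=> Qi; apply: (@eq_integrable _ _ _ _ _ _
    (fun y => (c i)%:E * (\1_(S i) y)%:E)%E) => //.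
  by apply: integrableZl => //; exact: intS.
transitivity (\int[lebesgue_rV R n]_y (\sum_(i | Q i) c i * \1_(S i) y)).
  rewrite Rintegral_sum//; apply: eq_bigr => i Qi.
  rewrite RintegralZl//; last exact: intS.
  by rewrite /Rintegral integral_indic ?setIT//; exact: mS.
rewrite /Rintegral (ae_eq_integral (cst 0%E)) ?integral0//.
  have /measurable_int := integrable_sum_EFin (index_enum I) measurableT intcS.
  exact.
(* The base points of the lines inside the planes of faces parallel to the
   axis. *)
pose N i : set 'rV[R]_n := if P i && ((h i).1 0 k == 0)
  then hyperplane (col' k (h i).1, (h i).2) else set0.
apply: (@negligibleS _ _ _ _ (\bigcup_i N i `|`
  shadow k (boundary K `\` \bigcup_(i in [set i | P i]) f i))); last first.
  apply: negligibleU; last exact: within_ridges_shadow.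
  apply: negligible_finbigcup => i; rewrite /N.
  case: ifPn => [/andP[Pi /eqP hk]|_]; last exact: negligible_set0.
  apply: hyperplane_negligible; apply: col'_neq0 => //.
  exact/dot_eq1_neq0/h1.
move=> y /=; apply: contra_notP => /not_orP[yN yB] _.
have Ny i : P i -> (h i).1 0 k = 0 -> ~ shadow k (f i) y.
  move=> Pi hk [t /(fh _ Pi) ft]; apply: yN; exists i => //.
  rewrite /N Pi hk eqxx/= /hyperplane/=.
  by move: ft; rewrite /hyperplane/= dot_ins hk mul0r add0r.
have bdry_y t : boundary K (ins k t y) -> exists2 i, P i & f i (ins k t y).
  by move=> bt; apply: contrapT => nf; apply: yB; exists t; split.
have E := exits_entries oK bK tf fh fnu sg1 bdry_y Ny.
congr EFin; rewrite -[RHS]E [RHS](bigID (fun i => (h i).1 0 k != 0))/=.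
rewrite [X in _ = _ + X]big1 ?addr0// => i /andP[_ /negPn/eqP ->].
by rewrite mulr0 sgr0 mul0r.
Qed.

(** * Cells and faces of a mesh *)

(** The sign with which a face enters the boundary of the cell [K]: [a] is the
    cell on the inner side of the face, [b] the one on the outer side. *)
Definition incidence (R : realType) (T : eqType) (a : T) (b : option T) (K : T)
    : R := (a == K)%:R - (b == Some K)%:R.

(** The cylinder of height one over a planar set has the area of that set as its
    volume. *)
Definition area (R : realType) d nc (M : mesh R d nc) (e : 'I_(nface M)) : R :=
  fine (lebesgue_rV R d (cylinder (fplane e) (face e))).

Lemma bounded_lebesgue_cylinder (R : realType) n (h : 'rV[R]_n * R)
    (f : set 'rV[R]_n) M :
  measurable f -> (forall x i, f x -> `|x 0 i| <= M) ->
  (lebesgue_rV R n (cylinder h f) < +oo)%E.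
Proof.
move=> mf fM; apply: (@bounded_lebesgue_rV _ _ _ (M + \sum_j `|h.1 0 j|)).
  exact: measurable_cylinder.
move=> x i [/andP[r0 r1] fx].
rewrite -(subrK ((dot h.1 x - h.2) * h.1 0 i) (x 0 i)).
rewrite (le_trans (ler_normD _ _))// lerD//.
  by have := fM _ i fx; rewrite !mxE.
rewrite normrM gtr0_norm// (@le_trans _ _ `|h.1 0 i|)//.
  by rewrite ler_piMl// ltW.
by rewrite (bigD1 i)//= lerDl sumr_ge0.
Qed.

Section mesh_theory.
Context (R : realType) (d nc : nat) (Omega : set 'rV[R]_d).
Variable M : mesh R d nc.
Hypothesis hM : is_mesh Omega M.
Implicit Types (e : 'I_(nface M)) (i : 'I_nc).

Lemma face_hyperplane e : face e `<=` hyperplane (fplane e).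
Proof. by case: hM => _ [_ _ /(_ e)[U _ ->] _] _ _ x []. Qed.

Lemma measurable_face e : measurable (face e).
Proof.
case: hM => _ [_ _ /(_ e)[U oU ->] _] _ _.
by apply: measurableI; [exact: open_rV_measurable|exact: measurable_hyperplane].
Qed.

Lemma cell_open i : open (cell M i).
Proof. by case: hM => -[] /(_ i) -[]. Qed.

Lemma measurable_cell i : measurable (cell M i).
Proof. by apply: open_rV_measurable; exact: cell_open. Qed.

Lemma cell_coord i : exists B, forall x j, cell M i x -> `|x 0 j| <= B.
Proof.
case: hM => -[] /(_ i)[_ _ _ bK _] _ _ _ _ _ _.
exact: bounded_coord bK.
Qed.

Lemma cell_lty i : (lebesgue_rV R d (cell M i) < +oo)%E.
Proof.
have [B cB] := cell_coord i.
exact: bounded_lebesgue_rV (measurable_cell i) cB.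
Qed.

Lemma fnormal_unit e : dot (fnormal e) (fnormal e) = 1.
Proof. by case: hM => _ [_ /(_ e)]. Qed.

Lemma face_inner_normal e x :
  face e x -> outward_normal (cell M (finner e)) x (fnormal e).
Proof. by case: hM => _ _ + _ => /[apply] -[]. Qed.

Lemma cylinder_face_lty e :
  (lebesgue_rV R d (cylinder (fplane e) (face e)) < +oo)%E.
Proof.
have [B cB] := cell_coord (finner e).
apply: (@bounded_lebesgue_cylinder _ _ _ _ (B + 1) (measurable_face e)).
move=> x j ex; apply: closure_coord => [z|]; first exact: cB.
exact: outward_normal_closure (fnormal_unit e) (face_inner_normal ex).
Qed.

(** Otherwise the cell would lie on both sides of the face. *)
Lemma fouter_neq e : fouter e != Some (finner e).
Proof.
apply/eqP => eK; have [x ex] : face e !=set0 by case: hM => _ [].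
have out1 := face_inner_normal ex.
have out2 : outward_normal (cell M (finner e)) x (- fnormal e).
  by case: hM => _ _ /(_ e x ex)[_] + _; rewrite eK.
have [z [Kz [z1 z2]]] :=
  outward_normal_closure (fnormal_unit e) out1 (filterI out1 out2).
have := z1.1 Kz; have := z2.1 Kz; rewrite dotNl; lra.
Qed.

Lemma mesh_closed_surface i :
  \sum_(e : 'I_(nface M)) (incidence R (finner e) (fouter e) i * area e) *:
    fnormal e = 0.
Proof.
pose P e := (finner e == i) || (fouter e == Some i).
pose s e := incidence R (finner e) (fouter e) i.
rewrite (bigID P)/= [X in _ + X]big1 ?addr0; last first.
  move=> e; rewrite negb_or => /andP[/negbTE ei /negbTE eo].
  by rewrite /incidence ei eo subrr mul0r scale0r.
have sP e : P e -> s e = if finner e == i then 1 else - 1.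
  rewrite /P /s /incidence; case: eqP => [<- _|_ /= ->]; last by rewrite sub0r.
  by rewrite (negbTE (fouter_neq e)) subr0.
have -> : \sum_(e | P e) (incidence R (finner e) (fouter e) i * area e) *:
    fnormal e = \sum_(e | P e)
    (s e * fine (lebesgue_rV R d (cylinder (fplane e) (face e)))) *: fnormal e.
  by [].
apply: (@closed_surface _ _ (cell M i)).
- exact: cell_open.
- by case: hM => -[] /(_ i) [].
- by case: hM => _ [].
- by move=> e _; exact: measurable_face.
- by move=> e _; exact: fnormal_unit.
- by move=> e _; exact: face_hyperplane.
- move=> e x Pe ex; rewrite sP//.
  case: eqP Pe => [<- _|ei]; first by rewrite scale1r; exact: face_inner_normal.
  rewrite /P; case: eqP => //= _ /eqP eo.
  by rewrite scaleN1r; case: hM => _ _ /(_ e x ex)[_] + _; rewrite eo.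
- by move=> e Pe; rewrite sP//; case: ifP; [left|right].
- case: hM => _ _ _ /(_ i); congr (within_ridges (_ `\` _)).
  apply/seteqP; split => x [e eK ex]; exists e => //=; move: eK; rewrite /P/=.
    by case=> ->; rewrite eqxx ?orbT.
  by case/orP => /eqP; [left|right].
Qed.

End mesh_theory.

(** * Integrals over product sets *)

Lemma integrable_bounded d (T : measurableType d) (R : realType)
    (mu : {measure set T -> \bar R}) (D : set T) (f : T -> R) (B : R) :
  measurable D -> (mu D < +oo)%E -> measurable_fun D f ->
  (forall x, D x -> `|f x| <= B) -> mu.-integrable D (EFin \o f).
Proof.
move=> mD Doo mf fB; apply: measurable_bounded_integrable => //.
exists B; split; first exact: num_real.
by move=> C BC x Dx; exact: le_trans (fB _ Dx) (ltW BC).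
Qed.

Section Rintegral_setX.
Context d1 d2 (T1 : measurableType d1) (T2 : measurableType d2) (R : realType).
Variable m1 : {sigma_finite_measure set T1 -> \bar R}.
Variable m2 : {sigma_finite_measure set T2 -> \bar R}.
Variables (A : set T1) (B : set T2).
Hypotheses (mA : measurable A) (mB : measurable B).

Lemma Rintegral_setX_snd (f : T2 -> R) :
  (m1 A < +oo)%E -> m2.-integrable B (EFin \o f) ->
  (m1 \x m2)%E.-integrable (A `*` B) (EFin \o (f \o snd)) ->
  \int[(m1 \x m2)%E]_(z in A `*` B) f z.2 = fine (m1 A) * \int[m2]_(y in B) f y.
Proof.
move=> Aoo fB fAB; rewrite /Rintegral.
rewrite integral_mkcond -integral12_prod_meas1; last first.
  by apply/(integrable_mkcond _ _).1 => //; exact: measurableX.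
rewrite /fubini_F.
transitivity (fine (\int[m1]_(x in A) (\int[m2]_(y in B) (f y)%:E))%E).
  congr fine; rewrite [RHS]integral_mkcond; apply: eq_integral => x _.
  rewrite patchE; case: ifPn => xA.
    rewrite [RHS]integral_mkcond; apply: eq_integral => y _.
    by rewrite !patchE in_setX xA.
  by rewrite integral0_eq// => y _; rewrite patchE in_setX (negbTE xA).
rewrite integral_cst// muleC fineM//; last exact: integrable_fin_num.
by rewrite ge0_fin_numE.
Qed.

Lemma Rintegral_setX_fst (f : T1 -> R) :
  (m2 B < +oo)%E -> m1.-integrable A (EFin \o f) ->
  (m1 \x m2)%E.-integrable (A `*` B) (EFin \o (f \o fst)) ->
  \int[(m1 \x m2)%E]_(z in A `*` B) f z.1 = fine (m2 B) * \int[m1]_(x in A) f x.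
Proof.
move=> Boo fA fAB; rewrite -RintegralZl// /Rintegral.
rewrite integral_mkcond -integral12_prod_meas1; last first.
  by apply/(integrable_mkcond _ _).1 => //; exact: measurableX.
rewrite /fubini_F; congr fine; rewrite [RHS]integral_mkcond.
apply: eq_integral => x _.
rewrite patchE; case: ifPn => xA; last first.
  by rewrite integral0_eq// => y _; rewrite patchE in_setX (negbTE xA).
transitivity (\int[m2]_(y in B) (f x)%:E)%E.
  rewrite [RHS]integral_mkcond; apply: eq_integral => y _.
  by rewrite !patchE in_setX xA.
by rewrite integral_cst// EFinM fineK 1?muleC// ge0_fin_numE.
Qed.

End Rintegral_setX.

(** * Faces of the product mesh *)

Section faces.
Context (R : realType) (d : nat) (T : R).
Variables (Omegax Omegav : set 'rV[R]_d) (E : R -> 'rV[R]_d -> 'rV[R]_d).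
Hypothesis hE : C_W1oo T Omegax E.
Context (nx nv : nat).
Variables (Mx : mesh R d nx) (Mv : mesh R d nv).
Hypotheses (hMx : is_mesh Omegax Mx) (hMv : is_mesh Omegav Mv).
Implicit Types (K : 'I_nx * 'I_nv) (e : pface Mx Mv) (t : R).

Lemma pouter_neq e : pouter e != Some (pinner e).
Proof.
case: e => -[a b] /=.
  have := fouter_neq hMx a; case: (fouter a) => //= a'.
  by apply: contra => /eqP[->].
have := fouter_neq hMv b; case: (fouter b) => //= b'.
by apply: contra => /eqP[->].
Qed.

Definition pfoot e := foot (pnormal e) (poffset e).

(** The domain of the integral by which the surface integral over [e] is
    defined. *)
Definition prism e : set (phase R d) :=
  [set z | 0 < pdot (pnormal e) z - poffset e < 1 /\
           pface_set e (pfoot e z)].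

Definition speed e t (z : phase R d) : R :=
  pdot (pnormal e) (phase_velocity E t z).

Lemma prism_inl p :
  prism (inl p) = cylinder (fplane p.1) (face p.1) `*` cell Mv p.2.
Proof.
apply/seteqP; split => -[x v];
  rewrite /prism /cylinder /pfoot /foot /pdot /fnormal/=;
  rewrite dot0l addr0 scaler0 subr0.
  by move=> [? []].
by move=> [[? ?] ?].
Qed.

Lemma prism_inr p :
  prism (inr p) = cell Mx p.1 `*` cylinder (fplane p.2) (face p.2).
Proof.
apply/seteqP; split => -[x v];
  rewrite /prism /cylinder /pfoot /foot /pdot /fnormal/=;
  rewrite dot0l add0r scaler0 subr0.
  by move=> [? []].
by move=> [? [? ?]].
Qed.

Lemma speed_inl p t z :
  speed (inl p) t (pfoot (inl p) z) =
  dot (fnormal p.1) z.2.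
Proof. by rewrite /speed /pfoot /foot /pdot/= !dot0l !addr0 scaler0 subr0. Qed.

Lemma speed_inr p t z :
  speed (inr p) t (pfoot (inr p) z) =
  dot (fnormal p.2) (- E t z.1).
Proof. by rewrite /speed /pfoot /foot /pdot/= !dot0l !add0r scaler0 subr0. Qed.

Lemma measurable_prism e : measurable (prism e).
Proof.
case: e => p; rewrite ?prism_inl ?prism_inr; apply: measurableX.
- by apply: measurable_cylinder; exact: (measurable_face hMx).
- exact: (measurable_cell hMv).
- exact: (measurable_cell hMx).
- by apply: measurable_cylinder; exact: (measurable_face hMv).
Qed.

Lemma phase_lebesgueX A B : measurable A -> measurable B ->
  @phase_lebesgue R d (A `*` B) = (lebesgue_rV R d A * lebesgue_rV R d B)%E.
Proof. exact: product_measure1E. Qed.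

Lemma prism_lty e : (@phase_lebesgue R d (prism e) < +oo)%E.
Proof.
case: e => p; rewrite ?prism_inl ?prism_inr phase_lebesgueX.
- by apply: lte_mul_pinfty => //; rewrite ?ge0_fin_numE//;
    [exact: (cylinder_face_lty hMx)|exact: (cell_lty hMv)].
- by apply: measurable_cylinder; exact: (measurable_face hMx).
- exact: (measurable_cell hMv).
- by apply: lte_mul_pinfty => //; rewrite ?ge0_fin_numE//;
    [exact: (cell_lty hMx)|exact: (cylinder_face_lty hMv)].
- exact: (measurable_cell hMx).
- by apply: measurable_cylinder; exact: (measurable_face hMv).
Qed.

Lemma pvol_gt0 K : 0 < pvol Mx Mv K.
Proof.
rewrite /pvol fine_gt0// /pcell phase_lebesgueX;
  [|exact: (measurable_cell hMx)|exact: (measurable_cell hMv)].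
have cell0 n Om (M : mesh R d n) i : is_mesh Om M -> cell M i !=set0.
  by case=> -[] /(_ i) -[].
have gt0 n Om (M : mesh R d n) i : is_mesh Om M ->
    (0 < lebesgue_rV R d (cell M i))%E.
  move=> hM; apply: open_lebesgue_gt0; last exact: cell0 hM.
  exact: cell_open hM _.
rewrite mule_gt0/=; [|exact: gt0 hMx|exact: gt0 hMv].
apply: lte_mul_pinfty => //; rewrite ?ge0_fin_numE//.
  exact: (cell_lty hMx).
exact: (cell_lty hMv).
Qed.

Lemma measurable_E t i l : 0 <= t <= T ->
  measurable_fun (cell Mx i) (fun x => E t x 0 l).
Proof.
move=> tT; case: hE => /(_ t tT) cE _ _.
apply: measurable_fun_open_rV; first exact: (cell_open hMx).
move=> x; rewrite inE => Kx.
have [[_ _ subO _] _ _ _] := hMx.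
have Ox : x \in Omegax by rewrite inE; exact: subO Kx.
have := cE x Ox => cEx.
apply: (@continuous_comp _ _ _ (E t) (fun u : 'rV[R]_d => u 0 l)) => //.
exact: coord_continuous.
Qed.

Lemma measurable_speed e t : 0 <= t <= T ->
  measurable_fun (prism e)
    (fun z => speed e t (pfoot e z)).
Proof.
move=> tT; case: e => p.
  under eq_fun do rewrite speed_inl.
  apply: measurable_funTS.
  exact: (measurableT_comp (measurable_dot _) measurable_snd).
under eq_fun do rewrite speed_inr dotNr.
apply: measurable_funN; rewrite /dot; apply: measurable_sum => l.
apply: measurable_funM; first exact: measurable_cst.
apply: (@measurable_comp _ _ _ _ _ _ (cell Mx p.1) (fun x => E t x 0 l)).
- exact: (measurable_cell hMx).
- by move=> _ [z + <-]; rewrite prism_inr => -[].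
- exact: measurable_E.
- exact: measurable_funTS measurable_fst.
Qed.

End faces.

(** * Integrals of the flux over the faces *)

(** The velocity through a spatial face depends only on the velocity variable,
    and the acceleration through a face in velocity space only on the spatial
    variable.  With respect to the factor of the face it is thus a constant
    field [w x], and [x] ranges over a cell [D] of the other factor. *)
Lemma mesh_flux_conservation (R : realType) d nc (Omega : set 'rV[R]_d)
    (M : mesh R d nc) (i : 'I_nc) (D : set 'rV[R]_d)
    (w : 'rV[R]_d -> 'rV[R]_d) :
  is_mesh Omega M -> measurable D ->
  (forall f : 'I_(nface M), (lebesgue_rV R d).-integrable D
     (EFin \o (fun x => dot (fnormal f) (w x)))) ->
  \sum_(f : 'I_(nface M)) incidence R (finner f) (fouter f) i *
    (area f * \int[lebesgue_rV R d]_(x in D) dot (fnormal f) (w x)) = 0.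
Proof.
move=> hM mD iw.
transitivity (\sum_(f : 'I_(nface M)) \int[lebesgue_rV R d]_(x in D)
    ((incidence R (finner f) (fouter f) i * area f) * dot (fnormal f) (w x))).
  by apply: eq_bigr => f _; rewrite RintegralZl// mulrA.
rewrite -Rintegral_sum// => [|f _]; last first.
  apply: (@eq_integrable _ _ _ _ _ _ (fun x =>
    (incidence R (finner f) (fouter f) i * area f)%:E *
    (dot (fnormal f) (w x))%:E)%E) => //.
  apply: integrableZl; [exact: mD|exact: iw].
rewrite (@eq_Rintegral _ _ _ _ _ (cst 0)) => [|x _].
  by rewrite Rintegral_cst// mul0r.
rewrite /= -[RHS](dot0l (w x)) -(mesh_closed_surface hM i).
under eq_bigr do rewrite -dotZl.
by elim/big_rec2: _ => [|f a b _ ->]; rewrite ?dot0l// dotDl.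
Qed.

Section face_integrals.
Context (R : realType) (d : nat) (T : R).
Variables (Omegax Omegav : set 'rV[R]_d) (E : R -> 'rV[R]_d -> 'rV[R]_d).
Hypothesis hE : C_W1oo T Omegax E.
Context (nx nv : nat).
Variables (Mx : mesh R d nx) (Mv : mesh R d nv).
Hypotheses (hMx : is_mesh Omegax Mx) (hMv : is_mesh Omegav Mv).
Variables (kind : pface Mx Mv -> flux_type).
Variable alpha : pface Mx Mv -> R -> phase R d -> R.
Hypothesis halpha : dissipation E T kind alpha.
Variable B : R.
Hypothesis alphaB : forall e (t : R) z, 0 <= t <= T ->
  pface_set e z -> alpha e t z <= B.
Implicit Types (K : 'I_nx * 'I_nv) (e : pface Mx Mv) (t : R).

Let inc e K : R := incidence R (pinner e) (pouter e) K.

Lemma speed_le_alpha e t z : 0 <= t <= T -> pface_set e z ->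
  `|speed E e t z| <= alpha e t z.
Proof.
move=> tT ez; case: halpha => _ [ag /(_ t tT e)].
case: (kind e) => [->//|[c /(_ z ez)[-> //]]|/(_ z ez)[-> //]].
Qed.

(** On a face the dissipation parameter is constant or equal to the normal
    speed. *)
Lemma measurable_alpha e t : 0 <= t <= T ->
  measurable_fun (prism e) (fun z => alpha e t (pfoot e z)).
Proof.
move=> tT; case: halpha => _ [ag /(_ t tT e)].
have ms : measurable_fun (prism e) (fun z => `|speed E e t (pfoot e z)|).
  by apply: measurableT_comp => //; exact: (measurable_speed hE hMx).
case: (kind e) => [aE|[c aE]|aE].
- apply: eq_measurable_fun ms => z; rewrite inE => -[_ ez].
  by rewrite aE.
- apply: (eq_measurable_fun (cst c)); last exact: measurable_cst.
  by move=> z; rewrite inE => -[_ ez]; have [->] := aE _ ez.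
- apply: (eq_measurable_fun (cst (ag t))); last exact: measurable_cst.
  by move=> z; rewrite inE => -[_ ez]; have [->] := aE _ ez.
Qed.

Lemma integrable_alpha e t : 0 <= t <= T ->
  (@phase_lebesgue R d).-integrable (prism e)
    (EFin \o (fun z => alpha e t (pfoot e z))).
Proof.
move=> tT; apply: (@integrable_bounded _ _ _ _ _ _ B).
- exact: (measurable_prism hMx hMv).
- exact: (prism_lty hMx hMv).
- exact: measurable_alpha.
- move=> z [_ ez]; rewrite ger0_norm; first exact: alphaB.
  exact: le_trans (speed_le_alpha tT ez).
Qed.

Lemma integrable_speed e t : 0 <= t <= T ->
  (@phase_lebesgue R d).-integrable (prism e)
    (EFin \o (fun z => speed E e t (pfoot e z))).
Proof.
move=> tT; apply: (@integrable_bounded _ _ _ _ _ _ B).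
- exact: (measurable_prism hMx hMv).
- exact: (prism_lty hMx hMv).
- exact: (measurable_speed hE hMx).
- move=> z [_ ez]; apply: le_trans (speed_le_alpha tT ez) _; exact: alphaB.
Qed.

Definition face_alpha e t : R := face_integral e (alpha e t).
Definition face_speed e t : R := face_integral e (speed E e t).

Lemma face_speed_le e t : 0 <= t <= T -> `|face_speed e t| <= face_alpha e t.
Proof.
move=> tT.
apply: le_trans (le_normr_Rintegral _ (integrable_speed e tT)) _.
  exact: (measurable_prism hMx hMv).
apply: le_Rintegral.
- exact: (measurable_prism hMx hMv).
- have /integrable_norm := integrable_speed e tT.
  by [].
- exact: (integrable_alpha e tT).
- by move=> z [_ ez]; exact: speed_le_alpha.
Qed.

Lemma face_alpha_le e t : 0 <= t <= T ->
  face_alpha e t <= Num.max B 0 * fine (@phase_lebesgue R d (prism e)).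
Proof.
move=> tT; rewrite -Rintegral_cst; last exact: (measurable_prism hMx hMv).
apply: le_Rintegral.
- exact: (measurable_prism hMx hMv).
- exact: (integrable_alpha e tT).
- apply: (@integrable_bounded _ _ _ _ _ _ (Num.max B 0)) => //.
  + exact: (measurable_prism hMx hMv).
  + exact: (prism_lty hMx hMv).
  + by move=> z _; rewrite ger0_norm// le_max lexx orbT.
- by move=> z [_ ez]; rewrite le_max alphaB.
Qed.

Lemma face_integral_flux e t K (um up : R) : 0 <= t <= T -> face_of K e ->
  face_integral e (fun z => flux E alpha t K e z um up) =
  inc e K * face_speed e t * ((um + up) / 2) +
  face_alpha e t * ((um - up) / 2).
Proof.
move=> tT Ke.
have fluxE z : flux E alpha t K e z um up =
    (inc e K * ((um + up) / 2)) * speed E e t z + ((um - up) / 2) * alpha e t z.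
  have -> : flux E alpha t K e z um up =
    inc e K * speed E e t z * ((um + up) / 2) + alpha e t z / 2 * (um - up).
    rewrite /flux; congr (_ * _ + _); rewrite /cell_normal /inc /incidence.
    case: eqP Ke => [<- _|eK].
      by rewrite (negbTE (pouter_neq hMx hMv e)) subr0 mul1r.
    rewrite /face_of; case: eqP => //= _ ->.
    by rewrite sub0r mulN1r /speed /pdot/= !dotNl opprD.
  ring.
rewrite /face_integral /surface_integral.
have -> : (fun z => flux E alpha t K e (foot (pnormal e) (poffset e) z) um up) =
  (fun z => (inc e K * ((um + up) / 2)) * speed E e t (pfoot e z) +
            ((um - up) / 2) * alpha e t (pfoot e z)).
  by apply/funext => z; rewrite fluxE.
have iZ f c : (@phase_lebesgue R d).-integrable (prism e) (EFin \o f) ->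
    (@phase_lebesgue R d).-integrable (prism e) (EFin \o (fun z => c * f z)).
  move=> fi; apply: (@eq_integrable _ _ _ _ _ _
    (fun y => c%:E * (f y)%:E)%E) => //.
  - exact: (measurable_prism hMx hMv).
  - by apply: integrableZl => //; exact: (measurable_prism hMx hMv).
rewrite (RintegralD (measurable_prism hMx hMv e)
  (iZ _ _ (integrable_speed e tT)) (iZ _ _ (integrable_alpha e tT))).
rewrite !RintegralZl.
- rewrite -[X in _ * X + _ = _]/(face_speed e t).
  rewrite -[X in _ + _ * X = _]/(face_alpha e t); ring.
- exact: (measurable_prism hMx hMv).
- exact: (integrable_alpha e tT).
- exact: (measurable_prism hMx hMv).
- exact: (integrable_speed e tT).
Qed.

Lemma integrable_dot_cell n j :
  (lebesgue_rV R d).-integrable (cell Mv j) (EFin \o dot n).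
Proof.
have [C cC] := cell_coord hMv j.
apply: (@integrable_bounded _ _ _ _ _ _ (\sum_i `|n 0 i| * C)).
- exact: (measurable_cell hMv).
- exact: (cell_lty hMv).
- exact: measurable_funTS (measurable_dot _).
- move=> v Kv; rewrite /dot (le_trans (ler_norm_sum _ _ _))//.
  by apply: ler_sum => i _; rewrite normrM ler_wpM2l// cC.
Qed.

Lemma face_speed_inl f j t : 0 <= t <= T ->
  face_speed (inl (f, j)) t =
  area f * \int[lebesgue_rV R d]_(v in cell Mv j) dot (fnormal f) v.
Proof.
move=> tT; have := integrable_speed (inl (f, j)) tT.
rewrite /face_speed /face_integral /surface_integral.
rewrite -/(pfoot (inl (f, j))) -/(prism (inl (f, j))) prism_inl/= => iS.
rewrite -Rintegral_setX_snd.
- apply: eq_Rintegral => z _; exact: speed_inl.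
- by apply: measurable_cylinder; exact: (measurable_face hMx).
- exact: (measurable_cell hMv).
- exact: (cylinder_face_lty hMx).
- exact: integrable_dot_cell.
- apply: eq_integrable iS.
    apply: measurableX; last exact: (measurable_cell hMv).
    by apply: measurable_cylinder; exact: (measurable_face hMx).
  by move=> z _; rewrite /= speed_inl.
Qed.

(** The bound on the dissipation parameter bounds the normal component of the
    electric field at all points of the cell: every such point is the spatial
    part of a point of a product face, as faces are nonempty. *)
Lemma integrable_dot_E i (f : 'I_(nface Mv)) t : 0 <= t <= T ->
  (lebesgue_rV R d).-integrable (cell Mx i) 
    (EFin \o (fun x => dot (fnormal f) (- E t x))).
Proof.
move=> tT; have [v0 fv0] : face f !=set0.
  by case: hMv => _ [].
apply: (@integrable_bounded _ _ _ _ _ _ B).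
- exact: (measurable_cell hMx).
- exact: (cell_lty hMx).
- under eq_fun do rewrite dotNr.
  apply: measurable_funN; rewrite /dot; apply: measurable_sum => l.
  apply: measurable_funM; first exact: measurable_cst.
  exact: (measurable_E hE hMx).
- move=> x Kx; have ez : pface_set (inr (i, f) : pface Mx Mv) (x, v0) by [].
  have := le_trans (speed_le_alpha tT ez) (alphaB tT ez).
  by rewrite /speed /pdot/= dot0l add0r.
Qed.

Lemma face_speed_inr i f t : 0 <= t <= T ->
  face_speed (inr (i, f)) t =
  area f * \int[lebesgue_rV R d]_(x in cell Mx i) dot (fnormal f) (- E t x).
Proof.
move=> tT; have := integrable_speed (inr (i, f)) tT.
rewrite /face_speed /face_integral /surface_integral.
rewrite -/(pfoot (inr (i, f))) -/(prism (inr (i, f))) prism_inr/= => iS.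
rewrite -Rintegral_setX_fst.
- apply: eq_Rintegral => z _; exact: speed_inr.
- exact: (measurable_cell hMx).
- by apply: measurable_cylinder; exact: (measurable_face hMv).
- exact: (cylinder_face_lty hMv).
- exact: integrable_dot_E.
- apply: eq_integrable iS.
    apply: measurableX; first exact: (measurable_cell hMx).
    by apply: measurable_cylinder; exact: (measurable_face hMv).
  by move=> z _; rewrite /= speed_inr.
Qed.

Lemma incidence_inl f j' i j :
  inc (inl (f, j')) (i, j) = incidence R (finner f) (fouter f) i * (j' == j)%:R.
Proof.
rewrite /inc /incidence/= xpair_eqE mulrBl -!natrM !mulnb.
congr (_ - (nat_of_bool _)%:R); by case: (fouter f).
Qed.

Lemma incidence_inr i' f i j :
  inc (inr (i', f)) (i, j) = incidence R (finner f) (fouter f) j * (i' == i)%:R.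
Proof.
rewrite /inc /incidence/= xpair_eqE mulrBl -!natrM !mulnb andbC.
congr (_ - (nat_of_bool _)%:R); case: (fouter f) => //= j'.
by rewrite -[Some j' == Some j]/(j' == j) andbC -xpair_eqE.
Qed.

(** The discrete counterpart of the velocity field being divergence free. *)
Lemma face_speed_conservation K t : 0 <= t <= T ->
  \sum_e inc e K * face_speed e t = 0.
Proof.
move=> tT; case: K => i j; rewrite big_sumType/=.
have -> : \sum_p inc (inl p) (i, j) * face_speed (inl p) t = 0.
  rewrite -[RHS](@mesh_flux_conservation _ _ _ _ _ i _ id hMx
    (measurable_cell hMv j)
    (fun f => integrable_dot_cell _ _)).
  transitivity (\sum_f \sum_j'
      inc (inl (f, j')) (i, j) * face_speed (inl (f, j')) t).
    by rewrite pair_bigA; apply: eq_bigr => -[].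
  apply: eq_bigr => f _; rewrite (bigD1 j)//= big1 ?addr0 => [|j' jj'].
    by rewrite incidence_inl eqxx mulr1 face_speed_inl.
  by rewrite incidence_inl (negbTE jj') mulr0 mul0r.
rewrite add0r.
rewrite -[RHS](@mesh_flux_conservation _ _ _ _ _ j _ (fun x => - E t x) hMv
  (measurable_cell hMx i) (fun f => integrable_dot_E _ _ tT)).
transitivity (\sum_f \sum_i'
    inc (inr (i', f)) (i, j) * face_speed (inr (i', f)) t).
  by rewrite exchange_big pair_bigA; apply: eq_bigr => -[].
apply: eq_bigr => f _; rewrite (bigD1 i)//= big1 ?addr0 => [|i' ii'].
  by rewrite incidence_inr eqxx mulr1 face_speed_inr.
by rewrite incidence_inr (negbTE ii') mulr0 mul0r.
Qed.

End face_integrals.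

(** * The explicit Euler step *)

(** [N e] and [A e] stand for the integrals of the normal velocity and of the
    dissipation parameter over the face [e], and [V K] for the volume of [K]. *)
Section monotone_step.
Context (R : realFieldType) (cT fT : finType).
Variables (inner : fT -> cT) (outer : fT -> option cT).
Hypothesis outer_neq : forall e, outer e != Some (inner e).
Variables (V : cT -> R) (A N : fT -> R) (tau : R) (u : cT -> R).

Let adj K e := (inner e == K) || (outer e == Some K).
Let inc e K : R := (inner e == K)%:R - (outer e == Some K)%:R.
Let opp K e : R :=
  if (if inner e == K then outer e else Some (inner e)) is Some K' then u K'
  else 0.

Hypothesis V_gt0 : forall K, 0 < V K.
Hypothesis N_le_A : forall e, `|N e| <= A e.
Hypothesis N_div0 : forall K, \sum_e inc e K * N e = 0.
Hypothesis tau_ge0 : 0 <= tau.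
Hypothesis cfl : forall K, tau * (\sum_(e | adj K e) A e) <= 2 * V K.

Let flux K e : R :=
  inc e K * N e * ((u K + opp K e) / 2) + A e * ((u K - opp K e) / 2).
Let new K : R := u K - tau / V K * \sum_(e | adj K e) flux K e.

Lemma sum_adj K : \sum_(e | adj K e) inc e K * N e = 0.
Proof.
rewrite -[RHS](N_div0 K) [RHS](bigID (adj K))/= [X in _ = _ + X]big1 ?addr0//.
by move=> e; rewrite /adj /inc negb_or => /andP[/negbTE-> /negbTE->];
  rewrite subrr mul0r.
Qed.

Let w K e : R := (A e - inc e K * N e) / 2.

Lemma w_ge0 K e : adj K e -> 0 <= w K e.
Proof.
have := N_le_A e; rewrite ler_norml /w /adj /inc => /andP[? ?].
case: eqP => [<-|_] /=.
  by rewrite (negbTE (outer_neq e)) subr0 mul1r; lra.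
by case: eqP => // _ _; rewrite sub0r mulN1r; lra.
Qed.

(** The new value is a convex combination of the old values in [K] and in its
    neighbours: the signed normal velocities sum up to zero, so that the flux
    through [e] may be replaced by [w K e] times the difference of the values,
    with a nonnegative weight, and [tau] times the sum of the weights is at most
    [V K] by the CFL condition.  The claim is the convexity of the square. *)
Lemma new_sqr_le K :
  V K * new K ^+ 2 <=
  V K * u K ^+ 2 + tau * \sum_(e | adj K e) w K e * (opp K e ^+ 2 - u K ^+ 2).
Proof.
pose D := \sum_(e | adj K e) w K e * (opp K e - u K).
pose S := \sum_(e | adj K e) w K e.
pose X := \sum_(e | adj K e) w K e * (opp K e - u K) ^+ 2.
have fluxD : \sum_(e | adj K e) flux K e = - D.
  rewrite -[RHS]addr0 -[X in _ + X](mulr0 (u K)) -[X in _ * X](sum_adj K).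
  rewrite /D mulr_sumr -sumrN -big_split/=.
  by apply: eq_bigr => e _; rewrite /flux /w; field.
have SE : S = (\sum_(e | adj K e) A e) / 2.
  rewrite /S /w -mulr_suml; congr (_ / _).
  by rewrite sumrB sum_adj subr0.
have sqE : \sum_(e | adj K e) w K e * (opp K e ^+ 2 - u K ^+ 2) =
    X + 2 * u K * D.
  rewrite /X /D mulr_sumr -big_split/=; apply: eq_bigr => e _; ring.
(* [m] is the increment of the value in [K]; the variance inequality around it
   avoids dividing by the sum of the weights, which may vanish. *)
pose m := tau / V K * D.
have X_ge : 0 <= X - 2 * m * D + m ^+ 2 * S.
  have -> : X - 2 * m * D + m ^+ 2 * S =
      \sum_(e | adj K e) w K e * (opp K e - u K - m) ^+ 2.
    rewrite /X /D /S !mulr_sumr -sumrN -!big_split/=.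
    by apply: eq_bigr => e _; ring.
  by apply: sumr_ge0 => e Ke; rewrite mulr_ge0 ?w_ge0// sqr_ge0.
have V0 := V_gt0 K.
have tS : tau * S <= V K by rewrite SE; have := cfl K; lra.
have mE : V K * m = tau * D by rewrite /m; field; rewrite gt_eqF.
have -> : new K = u K + m by rewrite /new fluxD /m; ring.
rewrite sqE.
have mS : m ^+ 2 * (tau * S) <= m ^+ 2 * V K by rewrite ler_wpM2l ?sqr_ge0.
have := mulr_ge0 tau_ge0 X_ge.
have -> : tau * (X - 2 * m * D + m ^+ 2 * S) =
  tau * X - 2 * m * (tau * D) + m ^+ 2 * (tau * S) by ring.
have -> : V K * (u K + m) ^+ 2 = V K * u K ^+ 2 + 2 * u K * (V K * m) +
  m * (V K * m) by ring.
rewrite (_ : m ^+ 2 * V K = m * (V K * m)) in mS; last by ring.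
rewrite mE in mS *; nra.
Qed.

Lemma sum_adj_face (F : cT -> R) e :
  \sum_(K | adj K e) F K =
  F (inner e) + (if outer e is Some K' then F K' else 0).
Proof.
rewrite (bigD1 (inner e)) /adj ?eqxx//=; congr (_ + _).
case oE : (outer e) => [K'|].
  apply: big_pred1 => K; rewrite /= !(eq_sym K).
  have := outer_neq e; rewrite oE => K'i.
  rewrite -[Some K' == Some K]/(K' == K).
  case: (eqVneq (inner e) K) => [<-|]//=; last by rewrite andbT.
  by rewrite ?andbF; apply/esym/negbTE.
by rewrite big_pred0// => K /=; rewrite orbF (eq_sym (inner e)) andbN.
Qed.

(** After rewriting the loss of each cell, an interior face gives to one of its
    neighbours what it takes from the other one, and a boundary face only
    takes, because the exterior value is zero. *)
Lemma face_balance :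
  \sum_K \sum_(e | adj K e) w K e * (opp K e ^+ 2 - u K ^+ 2) <= 0.
Proof.
have -> : \sum_K \sum_(e | adj K e) w K e * (opp K e ^+ 2 - u K ^+ 2) =
    \sum_K \sum_(e | adj K e) (w K e * opp K e ^+ 2 -
      (A e + inc e K * N e) / 2 * u K ^+ 2).
  (* The signed velocities sum up to zero, so their sign may be changed in the
     loss terms. *)
  apply: eq_bigr => K _; apply/eqP; rewrite -subr_eq0 -sumrB; apply/eqP.
  rewrite -[RHS](mulr0 (u K ^+ 2)) -[X in _ = _ * X](sum_adj K) mulr_sumr.
  by apply: eq_bigr => e _; rewrite /w; field.
rewrite (exchange_big_dep xpredT)//=; apply: sumr_le0 => e _.
rewrite sum_adj_face; have := N_le_A e; rewrite ler_norml => /andP[N1 N2].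
have out_ge0 : 0 <= (A e + N e) / 2 * u (inner e) ^+ 2.
  by rewrite mulr_ge0 ?sqr_ge0//; lra.
rewrite /w /inc /opp eqxx (negbTE (outer_neq e)) subr0 mul1r.
have := outer_neq e; case: (outer e) => [K'|_]; last first.
  by rewrite addr0 expr0n/= mulr0 sub0r oppr_le0.
rewrite -[Some K' == Some (inner e)]/(K' == inner e) => /negbTE K'i.
by rewrite eq_sym K'i eqxx sub0r mulN1r opprK; lra.
Qed.

Lemma monotone_step_contraction :
  \sum_K V K * new K ^+ 2 <= \sum_K V K * u K ^+ 2.
Proof.
apply: (le_trans (ler_sum _ (fun K _ => new_sqr_le K))).
by rewrite big_split/= gerDl -mulr_sumr mulr_ge0_le0// face_balance.
Qed.

End monotone_step.

(** * Projections and the Frobenius norm *)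

Section frobenius.
Context (R : realType).

Definition frob_sqr m n (A : 'M[R]_(m, n)) : R := \sum_i \sum_j A i j ^+ 2.

Lemma frob_sqr_ge0 m n (A : 'M[R]_(m, n)) : 0 <= frob_sqr A.
Proof. by apply: sumr_ge0 => i _; apply: sumr_ge0 => j _; rewrite sqr_ge0. Qed.

Lemma le_frob m n p q (A : 'M[R]_(m, n)) (B : 'M[R]_(p, q)) :
  frob_sqr A <= frob_sqr B -> frob A <= frob B.
Proof. by move=> AB; apply: ler_wsqrtr. Qed.

Lemma frob_sqrE m n (A : 'M[R]_(m, n)) : frob_sqr A = \tr (A^T *m A).
Proof.
rewrite /frob_sqr exchange_big; apply: eq_bigr => j _.
by rewrite !mxE; apply: eq_bigr => i _; rewrite mxE expr2.
Qed.

Lemma frob_sqr_tr m n (A : 'M[R]_(m, n)) : frob_sqr A^T = frob_sqr A.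
Proof.
rewrite /frob_sqr exchange_big; apply: eq_bigr => i _.
by apply: eq_bigr => j _; rewrite mxE.
Qed.

Lemma frob_sqr_isometry m n p (X : 'M[R]_(m, p)) (A : 'M[R]_(p, n)) :
  orthonormal_cols X -> frob_sqr (X *m A) = frob_sqr A.
Proof.
by move=> X1; rewrite !frob_sqrE trmx_mul -mulmxA (mulmxA X^T) X1 mul1mx.
Qed.

Lemma frob_sqr_contraction m n p (X : 'M[R]_(m, p)) (A : 'M[R]_(m, n)) :
  orthonormal_cols X -> frob_sqr (X^T *m A) <= frob_sqr A.
Proof.
move=> X1; rewrite -subr_ge0.
have := frob_sqr_ge0 (A - X *m (X^T *m A)).
suff -> : frob_sqr (A - X *m (X^T *m A)) = frob_sqr A - frob_sqr (X^T *m A).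
  by [].
rewrite !frob_sqrE -linearB/=; congr (\tr _).
rewrite [(A - _)^T]linearB/= mulmxBl !mulmxBr !trmx_mul trmxK.
by rewrite !mulmxA -[_ *m X^T *m X]mulmxA X1 mulmx1 subrr subr0.
Qed.

Lemma frob_sqr_proj m n p q (X : 'M[R]_(m, p)) (V : 'M[R]_(n, q))
    (A : 'M[R]_(m, n)) : orthonormal_cols X -> orthonormal_cols V ->
  frob_sqr (X *m (X^T *m A *m V) *m V^T) <= frob_sqr A.
Proof.
move=> X1 V1; rewrite -frob_sqr_tr trmx_mul trmxK frob_sqr_isometry//.
rewrite trmx_mul -frob_sqr_tr trmx_mul !trmxK frob_sqr_isometry//.
rewrite -frob_sqr_tr trmx_mul.
apply: le_trans (frob_sqr_contraction _ V1) _.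
by rewrite frob_sqr_tr frob_sqr_contraction.
Qed.

(** The new factors are computed from the Euler step projected onto the column
    spaces of [Xt] and [Vt], and neither an orthogonal projection nor the final
    truncation increases the Frobenius norm. *)
Lemma SAT_step_le nx nv (F : R -> 'M[R]_(nx, nv) -> 'M[R]_(nx, nv))
    eps1 eps2 tau t (U0 U1 : factored R nx nv) :
  SAT_step F eps1 eps2 tau t U0 U1 ->
  frob (mat U1) <= frob (mat U0 + tau *: F t (mat U0)).
Proof.
move=> [r [Xb [Sb [Vb [p [q [Xt [Vt /= [_ [X1 _] [V1 _] [_ _ _ _ le1]]]]]]]]]].
apply: (le_trans le1); apply: le_frob.
have -> : Xt^T *m fX U0 *m fS U0 *m (Vt^T *m fV U0)^T +
    tau *: (Xt^T *m F t (mat U0) *m Vt) =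
    Xt^T *m (mat U0 + tau *: F t (mat U0)) *m Vt.
  by rewrite mulmxDr mulmxDl -scalemxAr -scalemxAl /mat trmx_mul trmxK !mulmxA.
exact: frob_sqr_proj.
Qed.

End frobenius.

(** * Stability of the scheme *)

Section euler_step.
Context (R : realType) (d : nat) (T : R).
Variables (Omegax Omegav : set 'rV[R]_d) (E : R -> 'rV[R]_d -> 'rV[R]_d).
Hypothesis hE : C_W1oo T Omegax E.
Context (nx nv : nat).
Variables (Mx : mesh R d nx) (Mv : mesh R d nv).
Hypotheses (hMx : is_mesh Omegax Mx) (hMv : is_mesh Omegav Mv).
Variables (kind : pface Mx Mv -> flux_type).
Variable alpha : pface Mx Mv -> R -> phase R d -> R.
Hypothesis halpha : dissipation E T kind alpha.
Variable B : R.
Hypothesis alphaB : forall e (t : R) z, 0 <= t <= T ->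
  pface_set e z -> alpha e t z <= B.
Variable g : R -> phase R d -> R.
Hypothesis g0 : forall t z, g t z = 0.

(** With [u = U / sqrt V] the entries of the new matrix are [sqrt V] times the
    values of the monotone step, so that the Frobenius norm is the norm for
    which that step is contractive. *)
Lemma euler_step_contraction tau t (U : 'M[R]_(nx, nv)) :
  0 <= t <= T -> 0 <= tau ->
  (forall K, tau * (\sum_(e | face_of (Mx := Mx) (Mv := Mv) K e)
     face_alpha alpha e t) <= 2 * pvol Mx Mv K) ->
  frob (U + tau *: Fh E alpha g t U) <= frob U.
Proof.
move=> tT tau0 cfl; apply: le_frob.
have step := @monotone_step_contraction R _ _
  (@pinner _ _ _ _ Mx Mv) (@pouter _ _ _ _ Mx Mv)
  (pouter_neq hMx hMv) (pvol Mx Mv) (fun e => face_alpha alpha e t)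
  (fun e => face_speed E e t) tau (cell_value Mx Mv U)
  (pvol_gt0 hMx hMv) (fun e => face_speed_le hE hMx hMv halpha alphaB e tT)
  (fun K => face_speed_conservation hE hMx hMv halpha alphaB K tT) tau0 cfl.
have pairE (A : 'M[R]_(nx, nv)) : frob_sqr A = \sum_K A K.1 K.2 ^+ 2.
  by rewrite /frob_sqr pair_bigA.
have V_gt0 K := pvol_gt0 hMx hMv K.
have sqrt_gt0 K : 0 < Num.sqrt (pvol Mx Mv K) by rewrite sqrtr_gt0.
have sqrtK K : Num.sqrt (pvol Mx Mv K) ^+ 2 = pvol Mx Mv K.
  by rewrite sqr_sqrtr// ltW.
rewrite !pairE; apply: (le_trans _ (le_trans step _)); last first.
  apply: ler_sum => K _; rewrite /cell_value expr_div_n sqrtK mulrC divfK//.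
  by rewrite gt_eqF.
apply: ler_sum => K _; rewrite -[X in _ <= X * _](sqrtK K) -exprMn.
rewrite [X in X ^+ 2 <= _](_ : _ = Num.sqrt (pvol Mx Mv K) *
  (cell_value Mx Mv U K - tau / pvol Mx Mv K * \sum_(e | face_of K e)
     face_integral e (fun z => flux E alpha t K e z (cell_value Mx Mv U K)
       (if neighbour K e is Some K' then cell_value Mx Mv U K' else 0)))).
  rewrite le_eqVlt; apply/orP; left; apply/eqP; congr ((_ * (_ - _ * _)) ^+ 2).
  apply: eq_bigr => e Ke.
  exact: (face_integral_flux hE hMx hMv halpha alphaB _ _ tT Ke).
rewrite mxE [X in _ + X]mxE mxE -surjective_pairing mulrBr; congr (_ + _).
  by rewrite /cell_value mulrC divfK// gt_eqF.
have -> : \sum_(e | face_of K e) face_integral e (fun z =>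
      flux E alpha t K e z (cell_value Mx Mv U K) (outer_value g U K e t z)) =
    \sum_(e | face_of K e)
     face_integral e (fun z => flux E alpha t K e z (cell_value Mx Mv U K)
       (if neighbour K e is Some K' then cell_value Mx Mv U K' else 0)).
  apply: eq_bigr => e _; congr face_integral; apply/funext => z; congr flux.
  rewrite /outer_value; case: (neighbour K e) => //.
  by rewrite /boundary_value; case: e.
set S := \sum_(e | _) _; move: (sqrt_gt0 K) (sqrtK K).
by set r := Num.sqrt _ => r0 <-; field; rewrite gt_eqF.
Qed.

(** The bound on the dissipation parameter and the finiteness of the prisms make
    the supremum in the CFL condition finite; it is nonnegative because there is
    at least one cell. *)
Lemma tau_CFL_inv : 0 < T ->
  polytopal_domain Omegax -> polytopal_domain Omegav ->
  exists2 s : R, 0 <= s & (forall K t, 0 <= t <= T ->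
      (2 * pvol Mx Mv K)^-1 *
        (\sum_(e | face_of (Mx := Mx) (Mv := Mv) K e) face_alpha alpha e t)
      <= s)
    /\ tau_CFL alpha T = (s%:E^-1)%E.
Proof.
move=> T_gt0 [Ox0 _ _ _ _] [Ov0 _ _ _ _].
have cell_ex n Om (M : mesh R d n) : is_mesh Om M -> Om !=set0 ->
    exists i : 'I_n, True.
  by move=> [[_ _ _ sub] _ _ _] [x /sub[i]]; exists i.
have [i _] := cell_ex _ _ _ hMx Ox0; have [j _] := cell_ex _ _ _ hMv Ov0.
rewrite /tau_CFL; set Y := [set _ | _].
pose C := \sum_K (2 * pvol Mx Mv K)^-1 * \sum_(e : pface Mx Mv)
  Num.max B 0 * fine (@phase_lebesgue R d (prism e)).
have V2 K : 0 <= (2 * pvol Mx Mv K)^-1.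
  by rewrite invr_ge0 mulr_ge0// ltW// (pvol_gt0 hMx hMv).
have m_ge0 (e : pface Mx Mv) :
    0 <= Num.max B 0 * fine (@phase_lebesgue R d (prism e)).
  by rewrite mulr_ge0 ?le_max ?lexx ?orbT// fine_ge0.
have Y_le : (ereal_sup Y <= C%:E)%E.
  apply: ub_ereal_sup => _ [K [t [tT ->]]]; rewrite lee_fin.
  rewrite /C (bigD1 K)//= ler_wpDr//.
    by apply: sumr_ge0 => K' _; rewrite mulr_ge0// sumr_ge0.
  rewrite ler_wpM2l// [leRHS](bigID (face_of K))/= ler_wpDr ?sumr_ge0//.
  apply: ler_sum => e _; exact: (face_alpha_le hE hMx hMv halpha alphaB).
have Y_ge0 : (0 <= ereal_sup Y)%E.
  have T0 : 0 <= (0 : R) <= T by rewrite lexx ltW.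
  apply: (@le_trans _ _ ((2 * pvol Mx Mv (i, j))^-1 *
    (\sum_(e | face_of (Mx := Mx) (Mv := Mv) (i, j) e)
      face_alpha alpha e 0))%:E).
    rewrite lee_fin mulr_ge0// sumr_ge0// => e _.
    exact: le_trans (face_speed_le hE hMx hMv halpha alphaB e T0).
  by apply: ereal_sup_ubound; exists (i, j), 0.
have Yfin : ereal_sup Y \is a fin_num.
  by rewrite ge0_fin_numE// (le_lt_trans Y_le)// ltry.
exists (fine (ereal_sup Y)); first exact: fine_ge0.
rewrite fineK//; split=> // K t tT; rewrite -lee_fin fineK//.
by apply: ereal_sup_ubound; exists K, t.
Qed.

End euler_step.

Theorem theorem4p2 (R : realType) (d : nat) (hd : (0 < d)%N)
  (T : R) (hT : 0 < T)
  (Omegax Omegav : set 'rV[R]_d)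
  (hOx : polytopal_domain Omegax) (hOv : polytopal_domain Omegav)
  (E : R -> 'rV[R]_d -> 'rV[R]_d) (hE : C_W1oo T Omegax E)
  (nx nv : nat) (Mx : mesh R d nx) (Mv : mesh R d nv)
  (hMx : is_mesh Omegax Mx) (hMv : is_mesh Omegav Mv)
  (kind : pface Mx Mv -> flux_type)
  (alpha : pface Mx Mv -> R -> phase R d -> R)
  (halpha : dissipation E T kind alpha)
  (halpha_bounded : exists A : R, forall e (t : R) z, 0 <= t <= T ->
     pface_set e z -> alpha e t z <= A)
  (g : R -> phase R d -> R) (hg : forall t z, g t z = 0)
  (eps1 eps2 : R) (heps1 : 0 <= eps1) (heps2 : 0 <= eps2) :
  (0 < tau_CFL alpha T)%E /\
  forall (NT : nat) (tau : R), tau = T / NT%:R ->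
    0 < tau -> (tau%:E <= tau_CFL alpha T)%E ->
  forall U : nat -> factored R nx nv, svd_form (U 0%N) ->
    (forall n, (n < NT)%N ->
       SAT_step (Fh E alpha g) eps1 eps2 tau (n%:R * tau) (U n) (U n.+1)) ->
  forall n, n%:R * tau <= T -> frob (mat (U n)) <= frob (mat (U 0%N)).
Proof.
have [B alphaB] := halpha_bounded.
have [s s_ge0 [s_ge tauE]] := tau_CFL_inv hE hMx hMv halpha alphaB hT hOx hOv.
split.
  rewrite tauE inver; case: eqVneq => // s0.
  by rewrite lte_fin invr_gt0 lt_neqAle eq_sym s0.
move=> NT tau tauNT tau_gt0 tau_le U _ step.
have NT_gt0 : (0 < NT)%N.
  case: NT tauNT {step} => // tau0.
  by move: tau_gt0; rewrite tau0 invr0 mulr0 ltxx.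
have TE : T = NT%:R * tau by rewrite tauNT mulrC divfK// pnatr_eq0 -lt0n.
have taus : tau * s <= 1.
  move: tau_le; rewrite tauE inver.
  case: eqVneq => [->|s0]; first by rewrite mulr0.
  by rewrite lee_fin -ler_pdivlMr ?lt_neqAle ?s_ge0 1?eq_sym ?s0// div1r.
elim=> [//|n IHn] nT.
have nNT : (n < NT)%N by move: nT; rewrite TE ler_pM2r// ler_nat.
have nT' : n%:R * tau <= T by rewrite TE ler_pM2r// ler_nat ltnW.
apply: le_trans (IHn nT'); apply: le_trans (SAT_step_le (step _ nNT)) _.
have tT : 0 <= n%:R * tau <= T by rewrite nT' mulr_ge0// ltW.
apply: (euler_step_contraction hE hMx hMv halpha alphaB hg) => //.
  exact: ltW.
move=> K; have := ler_wpM2l (ltW tau_gt0) (s_ge K _ tT).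
move=> /le_trans/(_ taus); rewrite mulrCA mulrC ler_pdivrMr ?mul1r//.
by rewrite mulr_gt0// (pvol_gt0 hMx hMv).
Qed.
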